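(* Let $X \subset \mathbb{C}^{N+1}$ be the affine cone over a projective variety and let $Y \subset X$ be the affine cone over a projective subvariety of $\mathbb{P}(X)$. Let $I_X$ be the closure of $N^*_{X_{smooth}/\mathbb{C}^{N+1}}$ in $\mathbb{C}^{N+1} \times (\mathbb{C}^{N+1})^*$, with canonical projections $p : I_X \to (\mathbb{C}^{N+1})^*$ and $q : I_X \to \mathbb{C}^{N+1}$, and let $X^* = p(I_X)$. Assume that for generic $y \in Y$, the projectivization $\mathbb{P}\{p(q^{-1}(y))\}$ lies in $\mathbb{P}(X^* )_{smooth}$. Then the pair $(X,Y)$ satisfies generically along $Y$ the scheme-theoretic Whitney condition $(a)$; that is, it satisfies the scheme-theoretic Whitney condition $(a)$ at $y$ for generic $y \in Y$.
   Context: All varieties are over $\mathbb{C}$. For a variety $V$, $V_{smooth}$ is its smooth locus. For an affine cone $Z$ in a vector space, $\mathbb{P}(Z)$ denotes the corresponding closed projective scheme. $N^*_{X_{smooth}/\mathbb{C}^{N+1}}$ denotes the total space of the conormal bundle of $X_{smooth}$ in $\mathbb{C}^{N+1}$, i.e. the set of pairs $(x,\xi)$ with $x \in X_{smooth}$ and $\xi \in (\mathbb{C}^{N+1})^*$ vanishing on $T_{X,x}$. The variety $X^* = p(I_X)\subset(\mathbb{C}^{N+1})^*$ is the affine cone over the projective dual $\mathbb{P}(X^* )$ of $\mathbb{P}(X)$. For $y \in Y$, $q^{-1}(y)$ is the scheme-theoretic fibre, contained in $\{y\}\times(\mathbb{C}^{N+1})^*$, and $p(q^{-1}(y))$ is this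 (possibly non-reduced) scheme viewed as a closed subscheme of $(\mathbb{C}^{N+1})^*$. For $y\neq 0$ it is the affine cone over a projective scheme denoted $\mathbb{P}\{p(q^{-1}(y))\} \subset (\mathbb{P}^N)^*$. If $Z$ is the affine cone over a closed projective scheme, $Z^{\bullet} := Z \setminus \{0\}$, and $\big\langle \overline{T_{Z^{\bullet}}} \big\rangle$ denotes the linear span of the Zariski closure of the union of the (Zariski) tangent spaces to the scheme $Z^{\bullet}$, regarded as linear subspaces of the ambient vector space. The pair $(X,Y)$ satisfies the scheme-theoretic Whitney condition $(a)$ at $y\in Y$ if $$\big\langle \overline{T_{p(q^{-1}(y))^{\bullet}}} \big\rangle \subset T_{Y,y}^{\perp},$$ where $T_{Y,y}^{\perp} \subset (\mathbb{C}^{N+1})^*$ is the annihilator of $T_{Y,y} \subset \mathbb{C}^{N+1}$. ''Generic $y\in Y$'' means all $y$ in some non-empty (dense) Zariski open subset of $Y$. *)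

(* Defs.v *)
From mathcomp Require Import all_boot all_order all_algebra.
From mathcomp Require Import classical_sets reals.
From mathcomp Require Import mpoly complex.

Set Implicit Arguments.
Unset Strict Implicit.
Unset Printing Implicit Defensive.

Import GRing.Theory.
Local Open Scope ring_scope.
Local Open Scope classical_set_scope.

(* Vectors of K^n and covectors of (K^n)^* are both row vectors; a covector is
   given by its coordinates in the dual basis, see [pairing].  A point of
   K^n x (K^n)^* is a row vector [row_mx x xi] of length n + n, and the
   projections q and p are [lsubmx] and [rsubmx].  A closed subscheme of K^n is
   represented by its ideal, a closed subvariety by its set of points. *)

Section ZariskiTopology.
Variables (K : closedFieldType) (n : nat).
Implicit Types (J : set {mpoly K[n]}) (V Z : set 'rV[K]_n) (x y : 'rV[K]_n).

Definition zero_locus J : set 'rV[K]_n :=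
  [set x : 'rV[K]_n | forall f, J f -> f.@[x 0] = 0].

Definition vanishing_ideal Z : set {mpoly K[n]} :=
  [set f : {mpoly K[n]} | forall x, Z x -> f.@[x 0] = 0].

Definition zariski_closed Z := exists J, Z = zero_locus J.

Definition zariski_open Z := zariski_closed (~` Z).

Definition zariski_closure Z := zero_locus (vanishing_ideal Z).

Definition irreducible_set Z :=
  Z !=set0 /\
  forall A B, zariski_closed A -> zariski_closed B ->
    Z `<=` A `|` B -> Z `<=` A \/ Z `<=` B.

(* For irreducible V, where non-empty open subsets are dense. *)
Definition generically V (P : 'rV[K]_n -> Prop) :=
  exists U, [/\ zariski_open U, V `&` U !=set0 & forall y, V y -> U y -> P y].

(* A strictly increasing chain of length d of irreducible closed subsets. *)
Definition irreducible_chain V (d : nat) (C : nat -> set 'rV[K]_n) :=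
  (forall i, (i <= d)%N ->
     [/\ zariski_closed (C i), irreducible_set (C i) & C i `<=` V]) /\
  (forall i, (i < d)%N -> C i `<` C i.+1).

Definition has_dimension V (d : nat) :=
  (exists C, irreducible_chain V d C) /\
  (forall e C, irreducible_chain V e C -> (e <= d)%N).

Definition tangent_space J x : set 'rV[K]_n :=
  [set v : 'rV[K]_n |
     forall f, J f -> \sum_(i < n) (mderiv i f).@[x 0] * v 0 i = 0].

Definition var_tangent_space V x := tangent_space (vanishing_ideal V) x.

(* Used only for irreducible closed V: the local dimension of V at x is then
   the dimension of V. *)
Definition smooth_locus V : set 'rV[K]_n :=
  [set x : 'rV[K]_n | V x /\
    exists T : {vspace 'rV[K]_n},
      var_tangent_space V x = [set v | v \in T] /\ has_dimension V (\dim T)].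

Definition linear_span Z : set 'rV[K]_n :=
  [set v : 'rV[K]_n |
    forall U : {vspace 'rV[K]_n}, Z `<=` [set w | w \in U] -> v \in U].

Definition pairing x (xi : 'rV[K]_n) : K := \sum_(i < n) x 0 i * xi 0 i.

Definition annihilator Z : set 'rV[K]_n :=
  [set xi : 'rV[K]_n | forall v, Z v -> pairing v xi = 0].

End ZariskiTopology.

Section ProjectiveSpace.
Variables (K : closedFieldType) (N : nat).
Implicit Types (V : set 'rV[K]_N.+1).

(* The affine cone of a closed subset of P^N (or the empty set, when some
   equation is a non-zero constant). *)
Definition homogeneous_closed V :=
  exists J : set {mpoly K[N.+1]},
    (forall f, J f -> exists d : nat, f \is d.-homog) /\ V = zero_locus J.

(* V is the affine cone over P(V), with P(V) non-empty and irreducible for the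
   Zariski topology of P^N. *)
Definition cone_over_projective_variety V :=
  [/\ homogeneous_closed V,
      V `\ 0 !=set0 &
      forall A B, homogeneous_closed A -> homogeneous_closed B ->
        V `<=` A `|` B -> V `<=` A \/ V `<=` B].

(* The i-th standard chart of P^N: a |-> [a_0 : .. : 1 : .. : a_(N-1)] with 1
   in position i. *)
Definition chart_point (i : 'I_N.+1) (a : 'rV[K]_N) : 'rV[K]_N.+1 :=
  \row_j oapp (a 0) 1 (unlift i j).

Definition chart_coord (i : 'I_N.+1) (x : 'rV[K]_N.+1) : 'rV[K]_N :=
  (x 0 i)^-1 *: col' i x.

(* The non-zero x such that P(V) is smooth at [x]. *)
Definition proj_smooth_locus V : set 'rV[K]_N.+1 :=
  [set x : 'rV[K]_N.+1 | exists i, x 0 i != 0 /\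
     smooth_locus (chart_point i @^-1` V) (chart_coord i x)].

End ProjectiveSpace.

Section Conormal.
Variables (K : closedFieldType) (n : nat).
Implicit Types (X Y : set 'rV[K]_n) (y : 'rV[K]_n).

Definition conormal_bundle X : set 'rV[K]_(n + n) :=
  [set z : 'rV[K]_(n + n) | smooth_locus X (lsubmx z) /\
           annihilator (var_tangent_space X (lsubmx z)) (rsubmx z)].

Definition conormal_variety X := zariski_closure (conormal_bundle X).

Definition dual_variety X : set 'rV[K]_n := rsubmx @` conormal_variety X.

(* The ideal of the scheme-theoretic fibre q^-1(y), generated by the ideal of
   I_X and the x_i - y_i. *)
Definition fibre_ideal X y : set {mpoly K[n + n]} :=
  [set f : {mpoly K[n + n]} | exists g (h : 'I_n -> {mpoly K[n + n]}),
     vanishing_ideal (conormal_variety X) g /\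
     f = g + \sum_(i < n) h i * ('X_(lshift n i) - (y 0 i)%:MP)].

(* The ideal of the scheme p(q^-1(y)): the inverse image of [fibre_ideal] under
   the comorphism of p. *)
Definition dual_fibre_ideal X y : set {mpoly K[n]} :=
  [set f : {mpoly K[n]} | fibre_ideal X y (f \mPo [tuple 'X_(rshift n i) | i < n])].

Definition punctured_tangent_union (J : set {mpoly K[n]}) : set 'rV[K]_n :=
  \bigcup_(xi in zero_locus J `\ 0) tangent_space J xi.

Definition whitney_a X Y y :=
  linear_span (zariski_closure
    (punctured_tangent_union (dual_fibre_ideal X y)))
  `<=` annihilator (var_tangent_space Y y).

End Conormal.

(* Main.v *)
Require Import Defs.
From HB Require Import structures.
From mathcomp Require Import all_boot all_order all_algebra.
From mathcomp Require Import boolp classical_sets functions filter reals.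
From mathcomp Require Import closed_field mpoly complex ring.
Set Implicit Arguments.
Unset Strict Implicit.
Unset Printing Implicit Defensive.
Import GRing.Theory.
Local Open Scope ring_scope.
Local Open Scope classical_set_scope.

(** Write I_X for the conormal variety and let z = (y, xi) be one of its
    points, with y in Y and xi non-zero.  If v is tangent at xi to the scheme
    p(q^-1(y)), then (0, v) is tangent to I_X at z, because the restriction to
    {y} x K^n of an equation of I_X is an equation of that scheme
    ([zero_locus_fibre], [tangent_fibre]).  Condition (a) at y says that
    <w, v> = 0 for all w tangent to Y at y: annihilators are linear and closed,
    so it is enough to test these v ([orthogonal_whitney]).  As
    <w, v> is the value of the canonical symplectic form at (w, eta) and
    (0, v), two facts suffice.

    Generic submersion ([generic_submersion]): for generic y in Y, at every
    point z of I_X over y, every w in T_{Y,y} extends to a vector (w, eta) of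
    the Zariski tangent space of I_X at z.  This is generic smoothness,
    for all points of the fibre at once and without any stratification.  If it
    failed, the bad points would be dense over Y; an ultrafilter on them
    defines an ultraproduct F of copies of K and an F-point of I_X that
    projects to a generic point of Y.  The bad vectors w form one tangent
    vector to Y over F, which lifts since derivations extend in
    characteristic 0 ([tangent_lift]).  By Hilbert's basis theorem
    finitely many equations define tangency, so the lift is a lift of w at
    some bad point ([tangent_class]), a contradiction.

    Lagrangian tangent spaces ([conormal_isotropic]): the symplectic form
    vanishes on the whole Zariski tangent space of I_X at z as soon as the
    projective dual is smooth at [xi].  Near such a xi the dual variety has
    equations h_1, .., h_c with independent gradients, c being its
    codimension.  At a generic point (x, xi) of I_X the vector x is
    orthogonal to the tangent space of the dual (biduality, from
    [bundle_tangent_orthogonal]), so it is a combination of the gradients of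
    the h_j; Cramer's formula makes this a family of polynomial equations of
    I_X ([dual_span_equations]).  Their differentials at z force isotropy,
    by symmetry of the second derivatives of the h_j ([isotropic_tangent]).

    The codimension in the definition of smooth points comes from chains of
    irreducible closed sets.  Such a chain of length d gives d algebraically
    independent polynomials ([chain_alg_independent]), hence d independent
    tangent vectors at a generic point ([tangent_vectors]).  This is also why
    the smooth locus is open and I_X irreducible ([conormal_prime]). *)

(** * Substitution and derivations *)

Lemma mpoly_ring_ind (R : comNzRingType) n (P : {mpoly R[n]} -> Prop) :
  (forall c, P c%:MP) -> (forall i, P 'X_i) ->
  (forall p q, P p -> P q -> P (p + q)) ->
  (forall p q, P p -> P q -> P (p * q)) ->
  forall p, P p.
Proof.
move=> PC PX PD PM; elim/mpolyind => [|c m p _ _ Pp]; first by rewrite -mpolyC0.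
apply: (PD) => //; rewrite -mul_mpolyC; apply: (PM) => //.
rewrite mpolyXE_id; elim/big_ind: _ => [|p1 p2|i _]; [by rewrite -mpolyC1|exact: (PM)|].
by elim: (m i) => [|k IH]; rewrite ?expr0 -?mpolyC1 // exprS; apply: (PM).
Qed.

Lemma mderivXU (R : comNzRingType) n (i j : 'I_n) :
  ('X_j : {mpoly R[n]})^`M(i) = (i == j)%:R.
Proof.
rewrite mderivX mnm1E eq_sym; case: eqP => [<-|]; last by rewrite scale0r.
rewrite scale1r -mpolyX0; congr 'X_[_].
by apply/mnmP => l; rewrite mnmBE mnm0E subnn.
Qed.

(** The derivation has values in another ring, seen as a module through [e]:
    over an evaluation [e], it is a tangent vector at a point. *)
Definition derivation_over (A F : nzRingType) (e d : A -> F) :=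
  (forall a b, d (a + b) = d a + d b) /\
  (forall a b, d (a * b) = e a * d b + e b * d a).

(** The chain rule, for substitution of elements of any algebra: both sides
    are derivations that agree on constants and variables. *)
Lemma derivation_mmap (R A F : comNzRingType) n
    (k : {rmorphism R -> A}) (e : {rmorphism A -> F}) (d : A -> F)
    (X : 'I_n -> A) (f : {mpoly R[n]}) :
  derivation_over e d -> (forall c, d (k c) = 0) ->
  d (mmap k X f) = \sum_(i < n) e (mmap k X f^`M(i)) * d (X i).
Proof.
move=> [dD dM] dk; elim/mpoly_ring_ind: f => [c|j|p q IHp IHq|p q IHp IHq].
- rewrite mmapC dk big1 // => i _.
  by rewrite mderivC mmap0 rmorph0 mul0r.
- rewrite mmapX mmap1U (bigD1 j) //= big1 => [|i ij].
    by rewrite mderivXU eqxx !rmorph1 mul1r addr0.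
  by rewrite mderivXU (negPf ij) !rmorph0 mul0r.
- rewrite rmorphD dD IHp IHq -big_split; apply: eq_bigr => i _.
  by rewrite mderivD !rmorphD mulrDl.
- rewrite rmorphM dM IHp IHq !mulr_sumr -big_split; apply: eq_bigr => i _ /=.
  by rewrite mderivM rmorphD !rmorphM rmorphD !rmorphM; ring.
Qed.

Lemma rmorph_mmap (R A F : comNzRingType) n (k : {rmorphism R -> A})
    (e : {rmorphism A -> F}) (X : 'I_n -> A) (f : {mpoly R[n]}) :
  e (mmap k X f) = mmap (e \o k) (e \o X) f.
Proof.
elim/mpoly_ring_ind: f => [c|j|p q IHp IHq|p q IHp IHq].
- by rewrite !mmapC.
- by rewrite !mmapX !mmap1U.
- by rewrite !rmorphD IHp IHq.
- by rewrite !rmorphM IHp IHq.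
Qed.

(** * Lifting tangent vectors in characteristic zero *)

Section ExtendDerivation.
Variables (A : idomainType) (F : fieldType) (e : {rmorphism A -> F}).
Variables (d : A -> F) (theta : F).
Hypothesis charF0 : [pchar F] =i pred0.
Hypothesis der_d : derivation_over e d.
Hypothesis ker_d : forall a, e a = 0 -> d a = 0.

Lemma der_additive : zmod_morphism d.
Proof.
have [dD _] := der_d => a b; apply/(@addIr _ (d b)).
by rewrite -dD !subrK.
Qed.
#[local] HB.instance Definition _ := GRing.isZmodMorphism.Build A F d der_additive.

Definition poly_eval (p : {poly A}) : F := (map_poly e p).[theta].
Definition coef_der (p : {poly A}) : F := (map_poly d p).[theta].
Definition poly_der (t : F) (p : {poly A}) : F := coef_der p + poly_eval p^`() * t.

Lemma poly_eval_is_monoid_morphism : monoid_morphism poly_eval.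
Proof.
by split=> [|p q]; rewrite /poly_eval ?rmorph1 ?hornerC // rmorphM hornerM.
Qed.
Lemma poly_eval_is_zmod_morphism : zmod_morphism poly_eval.
Proof. by move=> p q; rewrite /poly_eval rmorphB hornerD hornerN. Qed.
HB.instance Definition _ :=
  GRing.isZmodMorphism.Build {poly A} F poly_eval poly_eval_is_zmod_morphism.
HB.instance Definition _ :=
  GRing.isMonoidMorphism.Build {poly A} F poly_eval poly_eval_is_monoid_morphism.

Lemma poly_evalX : poly_eval 'X = theta.
Proof. by rewrite /poly_eval map_polyX hornerX. Qed.
Lemma poly_evalC a : poly_eval a%:P = e a.
Proof. by rewrite /poly_eval map_polyC hornerC. Qed.

Lemma coef_derD p q : coef_der (p + q) = coef_der p + coef_der q.
Proof. by rewrite /coef_der raddfD hornerD. Qed.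

Lemma coef_derC a : coef_der a%:P = d a.
Proof. by rewrite /coef_der map_polyC hornerC. Qed.

Lemma coef_derMX p : coef_der (p * 'X) = coef_der p * theta.
Proof.
rewrite /coef_der -hornerMX; congr (_.[_]).
apply/polyP => i; rewrite coef_map !coefMX coef_map.
by case: ifP => // _; rewrite raddf0.
Qed.

Lemma coef_derM p q :
  coef_der (p * q) = poly_eval p * coef_der q + poly_eval q * coef_der p.
Proof.
have [_ dM] := der_d.
have derCM a r : coef_der (a%:P * r) = e a * coef_der r + poly_eval r * d a.
  elim/poly_ind: r => [|r c IH].
    by rewrite mulr0 /coef_der !raddf0 horner0 mulr0 mul0r addr0.
  rewrite mulrDr mulrA !coef_derD !coef_derMX -polyCM !coef_derC dM IH.
  by rewrite rmorphD rmorphM /= poly_evalX poly_evalC; ring.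
elim/poly_ind: p => [|p c IH].
  by rewrite mul0r /coef_der !raddf0 horner0 mulr0 mul0r addr0.
rewrite mulrDl mulrAC !coef_derD !coef_derMX derCM IH coef_derC.
by rewrite rmorphD rmorphM /= poly_evalX poly_evalC; ring.
Qed.

(** The extensions of [d] to polynomials over the evaluation at [theta] are
    parametrised by the value [t] that they give to the variable. *)
Lemma poly_der_derivation t : derivation_over poly_eval (poly_der t).
Proof.
split=> p q; rewrite /poly_der.
  by rewrite coef_derD derivD rmorphD; ring.
by rewrite coef_derM derivM rmorphD !rmorphM; ring.
Qed.

Lemma poly_derC t a : poly_der t a%:P = d a.
Proof. by rewrite /poly_der coef_derC derivC rmorph0 mul0r addr0. Qed.

Lemma poly_der_coef0 t p : map_poly e p = 0 -> poly_der t p = 0.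
Proof.
move=> ep0; have ep i : e p`_i = 0 by rewrite -coef_map ep0 coef0.
rewrite /poly_der /coef_der /poly_eval -deriv_map ep0 deriv0 horner0 mul0r addr0.
suff -> : map_poly d p = 0 by rewrite horner0.
by apply/polyP => i; rewrite coef_map coef0; apply: ker_d.
Qed.

(** Some extension factors through the values at [theta].  If [theta] is
    transcendental over the image of [e], any will do.  Otherwise [t] is forced
    by a relation [q] of minimal degree, whose derivative does not vanish at
    [theta] in characteristic 0; pseudo-division by [q] handles all other
    relations. *)
Lemma exists_poly_der : exists t, forall p, poly_eval p = 0 -> poly_der t p = 0.
Proof.
have [alg|noalg] := pselect (exists n, `[< exists q : {poly A},
    [/\ size q = n, map_poly e q != 0 & poly_eval q = 0] >]); last first.
  exists 0 => p p0; apply: poly_der_coef0; apply: contrapT => /eqP ep.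
  by apply: noalg; exists (size p); apply/asboolP; exists p.
case: (ex_minnP alg) => n /asboolP [q [szq eq0 q0]] minq.
have small (r : {poly A}) : (size r < size q)%N -> poly_eval r = 0 -> map_poly e r = 0.
  move=> rq r0; apply: contrapT => /eqP er.
  suff /minq : `[< exists q : {poly A},
      [/\ size q = size r, map_poly e q != 0 & poly_eval q = 0] >].
    by rewrite leqNgt -szq rq.
  by apply/asboolP; exists r.
have qN0 : q != 0 by apply: contra_neq eq0 => ->; rewrite rmorph0.
have elq : e (lead_coef q) != 0.
  apply: contra_neq eq0 => el.
  pose r := \poly_(i < (size q).-1) q`_i.
  have er : map_poly e q = map_poly e r.
    apply/polyP => i; rewrite !coef_map /r coef_poly; case: ltnP => // qi.
    rewrite [RHS]raddf0; move: qi; rewrite leq_eqVlt => /predU1P[<- //|qi].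
    by rewrite nth_default ?raddf0 //; move: qi; case: (size q).
  rewrite er; apply: small; last by rewrite /poly_eval -er.
  apply: leq_ltn_trans (size_poly _ _) _.
  by rewrite prednK // size_poly_gt0.
have q'0 : poly_eval q^`() != 0.
  apply/eqP => /small; rewrite lt_size_deriv // => /(_ isT) eq'.
  have sz2 : (1 < size q)%N.
    rewrite ltnNge; apply/negP => /size1_polyC qC; move: elq q0.
    by rewrite qC lead_coefC poly_evalC => /negP h /eqP.
  have : (map_poly e q^`())`_(size q).-2 = 0 by rewrite eq' coef0.
  rewrite coef_map coef_deriv raddfMn /=.
  have -> : (size q).-2.+1 = (size q).-1 by case: (size q) sz2 => [|[]].
  move/eqP; rewrite -mulr_natr mulf_eq0 (negPf elq) /=.
  by rewrite ((pcharf0P F).1 charF0); case: (size q) sz2 => [|[]].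
(* The only value of t for which the derivation kills q. *)
exists (- coef_der q / poly_eval q^`()) => p p0.
set t := - _ / _; have [dD dM] := poly_der_derivation t.
have dq : poly_der t q = 0 by rewrite /poly_der /t mulrC divfK // subrr.
have := Pdiv.Idomain.divp_eq p q.
set l := lead_coef q ^+ _ => eqp.
have szr := Pdiv.CommonIdomain.ltn_modp p q; rewrite qN0 in szr.
have r0 : poly_eval (modp p q) = 0.
  have := congr1 poly_eval eqp; rewrite -mul_polyC rmorphD !rmorphM /= p0 q0.
  by rewrite !mulr0 add0r.
have := congr1 (poly_der t) eqp.
rewrite -mul_polyC dD !dM poly_evalC p0 q0 dq (poly_der_coef0 _ (small _ szr r0)).
rewrite !mulr0 !mul0r !addr0 => /eqP; rewrite mulf_eq0 rmorphXn expf_eq0.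
by rewrite (negPf elq) andbF => /eqP.
Qed.

End ExtendDerivation.

(** One variable is added for each coordinate of [zeta].  The new ring [A'] is
    an iterated polynomial ring; it is left abstract because only the images
    [X i] of the variables matter. *)
Lemma extend_derivation (F : fieldType) (charF0 : [pchar F] =i pred0) b
    (zeta : 'I_b -> F) (A : idomainType) (e : {rmorphism A -> F}) (d : A -> F) :
  derivation_over e d -> (forall a, e a = 0 -> d a = 0) ->
  exists (A' : idomainType) (j : {rmorphism A -> A'})
         (e' : {rmorphism A' -> F}) (d' : A' -> F) (X : 'I_b -> A'),
    [/\ derivation_over e' d', forall a, e' a = 0 -> d' a = 0,
        forall a, e' (j a) = e a, forall a, d' (j a) = d a &
        forall i, e' (X i) = zeta i].
Proof.
elim: b zeta A e d => [|b IH] zeta A e d der_d ker_d.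
  exists A, idfun, e, d, (fun=> 0); split=> // -[] //.
have [t ker_t] := exists_poly_der (zeta ord0) charF0 der_d ker_d.
have [A' [j [e' [d' [X [der' ker' e'j d'j e'X]]]]]] :=
  IH (zeta \o lift ord0) _ (poly_eval e (zeta ord0)) (poly_der e d (zeta ord0) t)
    (poly_der_derivation _ der_d _) ker_t.
exists A', (j \o polyC), e', d', (fun i => oapp X (j 'X) (unlift ord0 i)).
split=> // [a|a|i] /=.
- by rewrite e'j /= poly_evalC.
- by rewrite d'j poly_derC.
- case: unliftP => [i' ->|->] /=; first exact: e'X.
  by rewrite e'j /= poly_evalX.
Qed.

(** The value at [v] of the differential of [f] at the point [zeta], which may
    have coordinates in an extension of the field of coefficients. *)
Definition point_diff (R F : comNzRingType) n (iota : R -> F)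
    (zeta v : 'I_n -> F) (f : {mpoly R[n]}) : F :=
  \sum_(i < n) mmap iota zeta f^`M(i) * v i.

(** The Zariski tangent space at [zeta] of the closure of [zeta] over the small
    field. *)
Definition point_tangent (R F : comNzRingType) n (iota : R -> F)
    (zeta v : 'I_n -> F) :=
  forall f : {mpoly R[n]}, mmap iota zeta f = 0 -> point_diff iota zeta v f = 0.

Lemma point_diff_derivation (R F : comNzRingType) n (iota : {rmorphism R -> F})
    (zeta v : 'I_n -> F) :
  derivation_over (mmap iota zeta) (point_diff iota zeta v).
Proof.
split=> f g; rewrite /point_diff.
  by rewrite -big_split; apply: eq_bigr => i _; rewrite mderivD rmorphD mulrDl.
rewrite !mulr_sumr -big_split; apply: eq_bigr => i _ /=.
by rewrite mderivM rmorphD !rmorphM; ring.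
Qed.

Lemma point_diffC (R F : comNzRingType) n (iota : {rmorphism R -> F})
    (zeta v : 'I_n -> F) c : point_diff iota zeta v c%:MP = 0.
Proof. by rewrite /point_diff big1 // => i _; rewrite mderivC rmorph0 mul0r. Qed.

Lemma point_diffX (R F : comNzRingType) n (iota : {rmorphism R -> F})
    (zeta v : 'I_n -> F) i : point_diff iota zeta v 'X_i = v i.
Proof.
rewrite /point_diff (bigD1 i) //= big1 => [|j ji].
  by rewrite mderivXU eqxx rmorph1 mul1r addr0.
by rewrite mderivXU (negPf ji) rmorph0 mul0r.
Qed.

(** A polynomial map is submersive at any point onto the closure of the image
    of this point: generic smoothness in characteristic 0.  The vector [v'] is
    a derivation of the coordinate ring at the image point, and the values of
    an extension of it at the coordinates of [zeta] are the lift. *)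
Lemma tangent_lift (K F : fieldType) (charF0 : [pchar F] =i pred0)
    (iota : {rmorphism K -> F}) a b (zeta : 'I_b -> F)
    (g : 'I_a -> {mpoly K[b]}) (v' : 'I_a -> F) :
  point_tangent iota (fun j => mmap iota zeta (g j)) v' ->
  exists v, point_tangent iota zeta v /\
            forall j, point_diff iota zeta v (g j) = v' j.
Proof.
move=> tan_v'; pose gz j := mmap iota zeta (g j).
have [A [j [e [d [X [der_d ker_d ej dj eX]]]]]] :=
  extend_derivation charF0 zeta (point_diff_derivation iota gz v') tan_v'.
pose k : {rmorphism K -> A} := j \o @mpolyC a K.
have dk c : d (k c) = 0 by rewrite /k /= dj point_diffC.
have ekX f : e (mmap k X f) = mmap iota zeta f.
  rewrite rmorph_mmap; have -> : e \o X = zeta by apply/funext => i; exact: eX.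
  have -> // : e \o k = iota.
  by apply/funext => c; rewrite /k /= ej; exact: mmapC.
have dkX f : d (mmap k X f) = point_diff iota zeta (d \o X) f.
  rewrite (derivation_mmap _ _ der_d dk); apply: eq_bigr => i _.
  by rewrite ekX.
exists (d \o X); split=> [f|i]; first by rewrite -dkX -ekX; apply: ker_d.
rewrite -dkX -(point_diffX iota gz v') -dj; have [dD _] := der_d.
apply/eqP; rewrite -subr_eq0; apply/eqP.
have dB x y : d (x - y) = d x - d y by apply/(@addIr _ (d y)); rewrite -dD !subrK.
by rewrite -dB; apply: ker_d; rewrite rmorphB ekX ej /= mmapX mmap1U subrr.
Qed.

(** * Hilbert's basis theorem *)

Section Noetherian.
Implicit Types (A B : comNzRingType).

Definition is_ideal A (I : set A) :=
  [/\ I 0, forall a b, I a -> I b -> I (a + b) & forall a b, I b -> I (a * b)].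

(** The ideal generated by [s], as an intersection: a property of its elements
    is proved by exhibiting an ideal of elements that have it. *)
Definition generated A (s : seq A) : set A :=
  [set f | forall J, is_ideal J -> (forall x, x \in s -> J x) -> J f].

Definition noetherian A := forall I : set A, is_ideal I ->
  exists2 s : seq A, (forall x, x \in s -> I x) & I `<=` generated s.

Lemma ideal_sub A (I : set A) a b : is_ideal I -> I a -> I b -> I (a - b).
Proof. by case=> _ ID IM Ia Ib; rewrite -mulN1r; apply: ID => //; apply: IM. Qed.

Lemma generated_ideal A (s : seq A) : is_ideal (generated s).
Proof.
split=> [J [] //|a b Ja Jb J idJ sJ|a b Jb J idJ sJ]; have [_ JD JM] := idJ.
  by apply: JD; [apply: Ja|apply: Jb].
by apply: JM; apply: Jb.
Qed.

Lemma mem_generated A (s : seq A) x : x \in s -> generated s x.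
Proof. by move=> xs J _; apply. Qed.

Lemma generated_sub A (s t : seq A) : {subset s <= t} -> generated s `<=` generated t.
Proof. by move=> st f sf J idJ tJ; apply: sf => // x /st; apply: tJ. Qed.

Lemma seq_choice (T1 T2 : eqType) (P : T1 -> T2 -> Prop) (s : seq T1) :
  (forall x, x \in s -> exists y, P x y) ->
  exists2 t : seq T2, (forall x, x \in s -> exists2 y, y \in t & P x y) &
    (forall y, y \in t -> exists2 x, x \in s & P x y).
Proof.
elim: s => [|x s IH] sP; first by exists [::].
have [y Pxy] := sP x (mem_head _ _).
have [z zs|t st ts] := IH; first by apply: sP; rewrite inE zs orbT.
exists (y :: t) => [z|z]; rewrite inE => /predU1P[->|].
- by exists y; rewrite ?mem_head.
- by move/st => [u ut Pu]; exists u; rewrite // inE ut orbT.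
- by exists x; rewrite ?mem_head.
- by move/ts => [u ut Pu]; exists u; rewrite // inE ut orbT.
Qed.

Lemma noetherian_surj A B (psi : {rmorphism A -> B}) :
  (forall b, exists a, psi a = b) -> noetherian A -> noetherian B.
Proof.
move=> surj noethA I [I0 ID IM].
have preim (J : set B) : is_ideal J -> is_ideal (psi @^-1` J).
  move=> [J0 JD JM]; split=> [|a b|a b] /=; first by rewrite /preimage /= rmorph0.
    by rewrite /preimage /= rmorphD; apply: JD.
  by rewrite /preimage /= rmorphM; apply: JM.
have [s sI Is] := noethA _ (preim I (And3 I0 ID IM)).
exists (map psi s) => [_ /mapP[x /sI Ix ->] //|f If J idJ sJ].
have [a fa] := surj f; rewrite -fa.
apply: (Is a) (preim J idJ) _; first by rewrite /preimage /= fa.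
by move=> x xs; apply: sJ; apply: map_f.
Qed.

Section HilbertBasis.
Variables (A : comNzRingType) (noethA : noetherian A) (I : set {poly A}).
Hypothesis idI : is_ideal I.

(** Besides 0, the leading coefficients of the elements of [I] of degree [n]. *)
Definition coef_ideal n : set A :=
  [set a | exists f : {poly A}, [/\ I f, (size f <= n.+1)%N & f`_n = a]].

Lemma coef_ideal_ideal n : is_ideal (coef_ideal n).
Proof.
have [I0 ID IM] := idI.
split=> [|a b [f [If sf fa]] [g [Ig sg gb]]|a b [g [Ig sg gb]]].
- by exists 0; rewrite size_poly0 coef0.
- exists (f + g); rewrite coefD fa gb; split=> //; first exact: ID.
  by apply: leq_trans (size_polyD _ _) _; rewrite geq_max sf.
- exists (a%:P * g); rewrite coefCM gb; split=> //; first exact: IM.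
  by rewrite mul_polyC; apply: leq_trans (size_scale_leq _ _) sg.
Qed.

Lemma coef_ideal_mono m n : (m <= n)%N -> coef_ideal m `<=` coef_ideal n.
Proof.
have [I0 ID IM] := idI.
move=> mn a [f [If sf fa]]; exists ('X^(n - m) * f); split; first exact: IM.
  apply: leq_trans (size_polyMleq _ _) _; rewrite size_polyXn addSn /=.
  by apply: leq_trans (leq_add (leqnn _) sf) _; rewrite addnS subnK.
by rewrite coefXnM ltnNge leq_subr /= subKn.
Qed.

Lemma size_le_coef0 (f : {poly A}) n : (size f <= n.+1)%N -> f`_n = 0 -> (size f <= n)%N.
Proof.
move=> /leq_sizeP sf fn; apply/leq_sizeP => j; rewrite leq_eqVlt => /predU1P[<- //|].
exact: sf.
Qed.

(** Degree by degree, generators of [coef_ideal n] lifted to [I] allow to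
    lower the degree. *)
Lemma generated_bounded n : exists2 s : seq {poly A}, (forall x, x \in s -> I x) &
  forall f, I f -> (size f <= n)%N -> generated s f.
Proof.
have [I0 ID IM] := idI.
elim: n => [|n [s0 s0I Is0]].
  exists [::] => // f _; rewrite leqn0 size_poly_eq0 => /eqP ->.
  by have [] := generated_ideal (Nil {poly A}).
have [sa saL Lsa] := noethA (coef_ideal_ideal n).
have [t sat tsa] := seq_choice saL.
have sub0 : {subset s0 <= s0 ++ t} by move=> x xs; rewrite mem_cat xs.
have subt : {subset t <= s0 ++ t} by move=> x xs; rewrite mem_cat xs orbT.
exists (s0 ++ t) => [x|f If sf].
  by rewrite mem_cat => /orP[/s0I //|/tsa[a _ []]].
have [gen0 genD genM] := generated_ideal (s0 ++ t).
pose J := [set a | exists g : {poly A},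
  [/\ generated (s0 ++ t) g, I g, (size g <= n.+1)%N & g`_n = a]].
have idJ : is_ideal J.
  split=> [|a b [g [Jg Ig sg ga]] [h [Jh Ih sh hb]]|a b [h [Jh Ih sh hb]]].
  - by exists 0; rewrite size_poly0 coef0.
  - exists (g + h); rewrite coefD ga hb; split=> //; first exact: genD.
      exact: ID.
    by apply: leq_trans (size_polyD _ _) _; rewrite geq_max sg.
  - exists (a%:P * h); rewrite coefCM hb; split=> //; first exact: genM.
      exact: IM.
    by rewrite mul_polyC; apply: leq_trans (size_scale_leq _ _) sh.
have [|a /sat[g gt [Ig sg ga]]|g [Jg Ig sg gf]] := Lsa f`_n _ J idJ.
- by exists f.
- by exists g; split=> //; apply: mem_generated; apply: subt.
rewrite -(subrK g f); apply: genD => //; apply: generated_sub sub0 _ _.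
apply: Is0; first exact: ideal_sub.
apply: size_le_coef0; last by rewrite coefB gf subrr.
by apply: leq_trans (size_polyD _ _) _; rewrite size_polyN geq_max sf.
Qed.

End HilbertBasis.

(** Only finitely many degrees are needed, because the increasing union of the
    ideals [coef_ideal I n] is itself finitely generated. *)
Lemma noetherian_poly A : noetherian A -> noetherian {poly A}.
Proof.
move=> noethA I idI; have [I0 ID IM] := idI.
pose L := [set a | exists n, coef_ideal I n a].
have idL : is_ideal L.
  split=> [|a b [m La] [n Lb]|a b [n Lb]].
  - by exists 0%N; have [] := coef_ideal_ideal idI 0.
  - exists (maxn m n); have [_ LD _] := coef_ideal_ideal idI (maxn m n).
    by apply: LD; [apply: coef_ideal_mono La|apply: coef_ideal_mono Lb];
      rewrite ?leq_maxl ?leq_maxr.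
  - by exists n; have [_ _ LM] := coef_ideal_ideal idI n; apply: LM.
have [sa saL Lsa] := noethA _ idL.
have [N LN] : exists N, L `<=` coef_ideal I N.
  suff [N saN] : exists N, forall a, a \in sa -> coef_ideal I N a.
    by exists N => a /Lsa; apply=> //; apply: coef_ideal_ideal.
  elim: sa saL {Lsa} => [|a s IH] sL; first by exists 0%N.
  have [n Ln] := sL a (mem_head _ _).
  have [x xs|N sN] := IH; first by apply: sL; rewrite inE xs orbT.
  exists (maxn n N) => x; rewrite inE => /predU1P[->|/sN].
    by apply: coef_ideal_mono Ln; rewrite ?leq_maxl.
  by apply: coef_ideal_mono; rewrite ?leq_maxr.
have [s sI Is] := generated_bounded noethA idI N.+1.
have [gen0 genD genM] := generated_ideal s.
exists s => // f; elim: {f}(size f) {-2}f (leqnn (size f)) => [|n IH] f sf If.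
  by apply: Is => //; apply: leq_trans sf _.
have [fN|Nf] := leqP (size f) N.+1; first exact: Is.
have [|g [Ig sg gf]] := LN f`_n; first by exists n, f.
have Nn : (N <= n)%N by rewrite -ltnS; apply: ltnW (leq_trans Nf sf).
have Jg : generated s ('X^(n - N) * g) by apply: genM; apply: Is.
rewrite -(subrK ('X^(n - N) * g) f); apply: genD => //; apply: IH; last first.
  by apply: ideal_sub => //; apply: IM.
apply: size_le_coef0; last first.
  by rewrite coefB coefXnM ltnNge leq_subr /= subKn // gf subrr.
apply: leq_trans (size_polyD _ _) _; rewrite size_polyN geq_max sf /=.
apply: leq_trans (size_polyMleq _ _) _; rewrite size_polyXn addSn /=.
by apply: leq_trans (leq_add (leqnn _) sg) _; rewrite addnS subnK.
Qed.

Lemma noetherian_field (K : fieldType) : noetherian K.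
Proof.
move=> I [I0 ID IM]; have [[a Ia aN0]|I_0] := pselect (exists2 a, I a & a != 0).
  exists [:: 1] => [x|b _].
    by rewrite inE => /eqP ->; rewrite -(mulVf aN0); apply: IM.
  have [_ _ genM] := generated_ideal [:: (1 : K)].
  by rewrite -[b]mulr1; apply: genM; apply: mem_generated; rewrite mem_head.
exists [::] => // a Ia; have -> : a = 0.
  by apply: contrapT => /eqP aN0; apply: I_0; exists a.
by have [] := generated_ideal (Nil K).
Qed.

(** Polynomials in [n.+1] variables as a quotient of polynomials in one variable
    over those in [n] variables; surjectivity is enough below. *)
Definition last_var_eval (K : comNzRingType) n (p : {poly {mpoly K[n]}}) :
  {mpoly K[n.+1]} := (map_poly (@mwiden n K) p).['X_ord_max].

Lemma last_var_eval_is_zmod_morphism K n : zmod_morphism (@last_var_eval K n).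
Proof. by move=> p q; rewrite /last_var_eval rmorphB hornerD hornerN. Qed.
Lemma last_var_eval_is_monoid_morphism K n : monoid_morphism (@last_var_eval K n).
Proof.
by split=> [|p q]; rewrite /last_var_eval ?rmorph1 ?hornerC // rmorphM hornerM.
Qed.
HB.instance Definition _ (K : comNzRingType) n :=
  GRing.isZmodMorphism.Build {poly {mpoly K[n]}} {mpoly K[n.+1]}
    (@last_var_eval K n) (@last_var_eval_is_zmod_morphism K n).
HB.instance Definition _ (K : comNzRingType) n :=
  GRing.isMonoidMorphism.Build {poly {mpoly K[n]}} {mpoly K[n.+1]}
    (@last_var_eval K n) (@last_var_eval_is_monoid_morphism K n).

Lemma last_var_evalX (K : comNzRingType) n : last_var_eval 'X = 'X_ord_max :> {mpoly K[n.+1]}.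
Proof. by rewrite /last_var_eval map_polyX hornerX. Qed.
Lemma last_var_evalC (K : comNzRingType) n (c : {mpoly K[n]}) : last_var_eval c%:P = mwiden c.
Proof. by rewrite /last_var_eval map_polyC hornerC. Qed.

Lemma last_var_eval_surj (K : comNzRingType) n (f : {mpoly K[n.+1]}) :
  exists p, last_var_eval p = f.
Proof.
elim/mpoly_ring_ind: f => [c|i|_ _ [p <-] [q <-]|_ _ [p <-] [q <-]].
- by exists (c%:MP)%:P; rewrite last_var_evalC mwidenC.
- case: (unliftP ord_max i) => [j ->|->]; last by exists 'X; rewrite last_var_evalX.
  exists ('X_j)%:P; rewrite last_var_evalC mwidenX mnmwiden1; congr 'X_[U_(_)].
  by apply: val_inj; rewrite /= /bump leqNgt ltn_ord.
- by exists (p + q); rewrite rmorphD.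
- by exists (p * q); rewrite rmorphM.
Qed.

Theorem noetherian_mpoly (K : fieldType) n : noetherian {mpoly K[n]}.
Proof.
elim: n => [|n IH]; last first.
  exact: noetherian_surj (@last_var_eval_surj K n) (noetherian_poly IH).
apply: (noetherian_surj (psi := @mpolyC 0 K)); last exact: noetherian_field.
elim/mpoly_ring_ind => [c|[]//|_ _ [p <-] [q <-]|_ _ [p <-] [q <-]].
- by exists c.
- by exists (p + q); rewrite rmorphD.
- by exists (p * q); rewrite rmorphM.
Qed.

End Noetherian.

(** * Ultraproduct fields and generic points *)

(** A field structure on the quotient by an ideal, given a function that
    inverts modulo the ideal.  It is used for the pointwise inverse of
    functions. *)
Section QuotientField.
Variables (R : comNzRingType) (I : R -> bool) (inv : R -> R).
Hypothesis idealI : idealr_closed I.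
Hypothesis invI : forall f, f \in I -> inv f \in I.
Hypothesis mulVI : forall f, f \notin I -> inv f * f - 1 \in I.

#[local] HB.instance Definition _ := isIdealr.Build R I idealI.

Definition quotient_field := {ideal_quot (I : idealr R)}.
#[local] HB.instance Definition _ := GRing.ComNzRing.on quotient_field.

Definition quotient_class : R -> quotient_field := \pi_quotient_field%qT.
#[local] HB.instance Definition _ := GRing.RMorphism.on quotient_class.

Lemma quotient_class_eq0 f : (quotient_class f == 0) = (f \in I).
Proof. by rewrite -[0](rmorph0 quotient_class) -Quotient.idealrBE subr0. Qed.

Lemma quotient_classK (x : quotient_field) : quotient_class (repr x) = x.
Proof. exact: reprK. Qed.

Definition quotient_inv (x : quotient_field) := quotient_class (inv (repr x)).

Lemma quotient_mulVf x : x != 0 -> quotient_inv x * x = 1.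
Proof.
move=> xN0; have /mulVI : repr x \notin I.
  by rewrite -quotient_class_eq0 [quotient_class _]quotient_classK.
rewrite -quotient_class_eq0 rmorphB rmorphM rmorph1 subr_eq0 => /eqP <-.
by congr (_ * _); rewrite [RHS]quotient_classK.
Qed.

Lemma quotient_invr0 : quotient_inv 0 = 0.
Proof.
apply/eqP; rewrite quotient_class_eq0 invI // -quotient_class_eq0; apply/eqP.
exact: quotient_classK.
Qed.

#[local] HB.instance Definition _ :=
  GRing.ComNzRing_isField.Build quotient_field quotient_mulVf quotient_invr0.

Lemma exists_quotient_field :
  exists (F : fieldType) (cls : {rmorphism R -> F}),
    (forall u, exists f, cls f = u) /\ (forall f, (cls f == 0) = (f \in I)).
Proof.
exists quotient_field, quotient_class; split; last exact: quotient_class_eq0.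
by move=> u; exists (repr u); apply: quotient_classK.
Qed.

End QuotientField.

(** The pointwise inverse of a function is an inverse on a set of the
    ultrafilter, unless the function vanishes on such a set. *)
Lemma ultraproduct_field (T : pointedType) (K : fieldType) (U : set_system T) :
  UltraFilter U ->
  exists (F : fieldType) (cls : {rmorphism (T -> K) -> F}),
    (forall u, exists f, cls f = u) /\
    (forall f, cls f = 0 <-> U [set z | f z = 0]).
Proof.
move=> ultraU; pose R : comNzRingType := T -> K.
pose I : pred R := fun f => `[< U [set z | f z = 0] >].
pose inv : R -> R := fun f z => (f z)^-1.
have idealI : idealr_closed I.
  split=> [||a f g /asboolP Uf /asboolP Ug].
  - by apply/asboolP; apply: filterS filterT.
  - apply/asboolP => U1; apply: (@filter_not_empty _ U).
    by apply: filterS U1 => z /= /eqP; rewrite oner_eq0.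
  - apply/asboolP; apply: filterS2 Uf Ug => z /= fz gz.
    have -> : (a * f + g) z = a z * f z + g z :> K by [].
    by rewrite fz gz mulr0 addr0.
have invI f : f \in I -> inv f \in I.
  move=> /asboolP Uf; apply/asboolP; apply: filterS Uf => z /=.
  by rewrite /inv => ->; rewrite invr0.
have mulVI f : f \notin I -> inv f * f - 1 \in I.
  move=> /asboolPn If; apply/asboolP.
  have [//|] := in_ultra_setVsetC [set z | f z = 0] ultraU.
  apply: filterS => z /= /eqP fz.
  have -> : (inv f * f - 1) z = (f z)^-1 * f z - 1 :> K by [].
  by rewrite mulVf ?subrr.
have [F [cls [cls_surj cls0]]] := exists_quotient_field idealI invI mulVI.
exists F, cls; split=> // f; split=> [/eqP|Uf]; last apply/eqP; rewrite cls0.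
  by move/asboolP.
exact/asboolP.
Qed.

Lemma derivation_kernel_ideal (A F : comNzRingType) (e : {rmorphism A -> F}) d :
  derivation_over e d -> is_ideal [set f | e f = 0 /\ d f = 0].
Proof.
move=> [dD dM]; have d0 : d 0 = 0 by apply/(@addIr _ (d 0)); rewrite -dD !add0r.
split=> [|a b [ea da] [eb db]|a b [eb db]] /=; first by rewrite rmorph0.
  by rewrite rmorphD dD ea eb da db addr0.
by rewrite rmorphM dM eb db !(mulr0, mul0r) addr0.
Qed.

Section GenericField.
Variables (K : closedFieldType) (m : nat).
Implicit Types (U : set_system 'rV[K]_m).

Definition const_fun (c : K) : 'rV[K]_m -> K := fun=> c.

Lemma const_fun_is_zmod_morphism : zmod_morphism const_fun.
Proof. by []. Qed.
Lemma const_fun_is_monoid_morphism : monoid_morphism const_fun.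
Proof. by []. Qed.
HB.instance Definition _ :=
  GRing.isZmodMorphism.Build K ('rV[K]_m -> K) const_fun const_fun_is_zmod_morphism.
HB.instance Definition _ :=
  GRing.isMonoidMorphism.Build K ('rV[K]_m -> K) const_fun const_fun_is_monoid_morphism.

Variables (U : set_system 'rV[K]_m) (F : fieldType).
Variable cls : {rmorphism ('rV[K]_m -> K) -> F}.
Hypothesis ultraU : UltraFilter U.
Hypothesis cls_surj : forall u, exists f, cls f = u.
Hypothesis cls0 : forall f, cls f = 0 <-> U [set z | f z = 0].

Definition const_class : {rmorphism K -> F} := cls \o const_fun.

Lemma const_class_pchar : [pchar K] =i pred0 -> [pchar F] =i pred0.
Proof. by move=> charK p; rewrite (fmorph_pchar const_class). Qed.

Lemma mmap_cls n (h : 'I_n -> 'rV[K]_m -> K) (f : {mpoly K[n]}) :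
  mmap const_class (cls \o h) f = cls (fun z => f.@[fun i => h i z]).
Proof.
elim/mpoly_ring_ind: f => [c|j|p q IHp IHq|p q IHp IHq].
- by rewrite mmapC; congr (cls _); apply/funext => z; rewrite mevalC.
- by rewrite mmapX mmap1U; congr (cls _); apply/funext => z; rewrite mevalXU.
- by rewrite rmorphD /= IHp IHq -rmorphD; congr (cls _); apply/funext => z; rewrite mevalD.
- by rewrite rmorphM /= IHp IHq -rmorphM; congr (cls _); apply/funext => z; rewrite mevalM.
Qed.

Lemma point_diff_cls n (h v : 'I_n -> 'rV[K]_m -> K) (f : {mpoly K[n]}) :
  point_diff const_class (cls \o h) (cls \o v) f =
  cls (fun z => \sum_(i < n) (f^`M(i)).@[fun i => h i z] * v i z).
Proof.
rewrite /point_diff.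
transitivity (cls (\sum_(i < n) (fun z => (f^`M(i)).@[fun i => h i z]) * v i)).
  by rewrite rmorph_sum; apply: eq_bigr => i _; rewrite mmap_cls rmorphM.
by congr (cls _); rewrite fct_sumE.
Qed.

(** The class of the identity map: the tautological point with coordinates in
    the ultraproduct, at which a polynomial vanishes if and only if it vanishes
    on a set of the ultrafilter. *)
Definition class_point : 'I_m -> F := fun i => cls (fun z => z 0 i).

Lemma mmap_class_point (f : {mpoly K[m]}) :
  mmap const_class class_point f = cls (fun z => f.@[z 0]).
Proof. exact: mmap_cls. Qed.

(** A tangent vector with coordinates in the ultraproduct is a family of vectors,
    almost all of which are tangent.  Each equation gives its own set of the
    ultrafilter, so this needs a finite list of equations. *)
Lemma tangent_class (I : set {mpoly K[m]}) (w : 'I_m -> 'rV[K]_m -> K) :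
  is_ideal I -> U (zero_locus I) -> point_tangent const_class class_point (cls \o w) ->
  U [set z | tangent_space I z (\row_i w i z)].
Proof.
move=> idI UI tan_w; have [s sI Is] := noetherian_mpoly idI.
have Us : U [set z : 'rV[K]_m |
    forall f, f \in s -> \sum_(i < m) (f^`M(i)).@[z 0] * w i z = 0].
  elim: s sI {Is} => [|f s IH] sI; first by apply: filterS filterT.
  have Uf : U [set z : 'rV[K]_m | \sum_(i < m) (f^`M(i)).@[z 0] * w i z = 0].
    apply/cls0; rewrite -[LHS](point_diff_cls (fun i (z : 'rV[K]_m) => z 0 i) w f).
    apply: tan_w.
    rewrite mmap_class_point; apply/cls0; apply: filterS UI => z; apply.
    by apply: sI; rewrite mem_head.
  have {}IH := IH (fun g gs => sI g (mem_behead (s := f :: s) gs)).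
  apply: filterS2 Uf IH => z fz sz g; rewrite inE => /predU1P[->//|]; exact: sz.
apply: filterS2 UI Us => z Iz sz f /Is If.
pose w' i := w i z.
have [|_ df0] := If _ (derivation_kernel_ideal (point_diff_derivation idfun (z 0) w')).
  by move=> g gs; split; [apply/Iz/sI|apply: sz].
rewrite -[RHS]df0; apply: eq_bigr => i _; by rewrite mxE.
Qed.

End GenericField.

Lemma exists_ultra_class (K : closedFieldType) m (B : set (set 'rV[K]_m)) :
  B !=set0 -> (forall b, B b -> b !=set0) ->
  (forall b c, B b -> B c -> exists2 d, B d & d `<=` b `&` c) ->
  exists (U : set_system 'rV[K]_m) (F : fieldType)
         (cls : {rmorphism ('rV[K]_m -> K) -> F}),
    [/\ UltraFilter U, B `<=` U, forall u, exists f, cls f = u &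
        forall f, cls f = 0 <-> U [set z | f z = 0]].
Proof.
move=> [b0 Bb0] BN0 BI.
have FB : Filter (filter_from B id) by apply: filter_from_filter => //; exists b0.
have PB := filter_from_proper FB BN0.
have [U [ultraU BU]] := ultraFilterLemma PB.
pose T : pointedType := HB.pack 'rV[K]_m (isPointed.Build 'rV[K]_m 0).
have [F [cls [cls_surj cls0]]] := @ultraproduct_field T K U ultraU.
exists U, F, cls; split=> // b Bb; apply: BU; exact: in_filter_from.
Qed.

(** * Generic submersion *)

Section ZariskiBasics.
Variables (K : closedFieldType) (n : nat).
Implicit Types (Y Z A B : set 'rV[K]_n).

Lemma closed_zero_set (f : {mpoly K[n]}) : zariski_closed [set x : 'rV[K]_n | f.@[x 0] = 0].
Proof.
by exists [set f]; apply/seteqP; split=> x; [move=> fx _ ->|apply].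
Qed.

Lemma open_nonzero_set (f : {mpoly K[n]}) : zariski_open [set x : 'rV[K]_n | f.@[x 0] != 0].
Proof.
rewrite /zariski_open.
have -> : ~` [set x : 'rV[K]_n | f.@[x 0] != 0] = [set x | f.@[x 0] = 0].
  by apply/seteqP; split=> x /=; [move/negP/negPn/eqP|move=> ->; rewrite eqxx].
exact: closed_zero_set.
Qed.

Lemma zariski_closedU A B : zariski_closed A -> zariski_closed B -> zariski_closed (A `|` B).
Proof.
move=> [J ->] [L ->]; exists [set h | exists f g, [/\ J f, L g & h = f * g]].
apply/seteqP; split=> x.
  move=> [Jx|Lx] _ [f [g [Jf Lg ->]]]; rewrite mevalM; first by rewrite (Jx f) ?mul0r.
  by rewrite (Lx g) ?mulr0.
move=> JLx; apply: contrapT => /not_orP[/existsNP[f /not_implyP[Jf /eqP fx]]].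
move=> /existsNP[g /not_implyP[Lg /eqP gx]].
have /eqP : (f * g).@[x 0] = 0 by apply: JLx; exists f, g.
by rewrite mevalM mulf_eq0 (negPf fx) (negPf gx).
Qed.

Lemma zariski_openI A B : zariski_open A -> zariski_open B -> zariski_open (A `&` B).
Proof. by rewrite /zariski_open setCI; apply: zariski_closedU. Qed.

Lemma irreducible_openI Y A B : irreducible_set Y -> zariski_open A -> zariski_open B ->
  Y `&` A !=set0 -> Y `&` B !=set0 -> Y `&` (A `&` B) !=set0.
Proof.
move=> [_ irrY] oA oB [a [Ya Aa]] [b [Yb Bb]]; apply: contrapT => YAB.
have [y Yy| |] := irrY _ _ oA oB; last 2 first.
- by move/(_ _ Ya); apply.
- by move/(_ _ Yb); apply.
apply: contrapT => /not_orP[/contrapT Ay /contrapT By].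
by apply: YAB; exists y.
Qed.

Lemma vanishing_ideal_ideal Z : is_ideal (vanishing_ideal Z).
Proof.
split=> [x _|f g If Ig x Zx|f g Ig x Zx]; first by rewrite meval0.
  by rewrite mevalD If // Ig // addr0.
by rewrite mevalM (Ig x) // mulr0.
Qed.

Lemma zero_locus_vanishing Z : Z `<=` zero_locus (vanishing_ideal Z).
Proof. by move=> x Zx f; apply. Qed.

End ZariskiBasics.

(** Generic smoothness, including the points where [V] is singular: bad points
    that are dense over [Y] have an ultraproduct to which [tangent_lift]
    applies. *)
Lemma generic_submersion (K : closedFieldType) (charK0 : [pchar K] =i pred0) n
    (Y : set 'rV[K]_n) (V : set 'rV[K]_(n + n)) :
  irreducible_set Y -> (forall z, V z -> Y (lsubmx z)) ->
  exists O, [/\ zariski_open O, Y `&` O !=set0 &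
    forall z, V z -> O (lsubmx z) ->
      forall w, var_tangent_space Y (lsubmx z) w ->
      exists eta, var_tangent_space V z (row_mx w eta)].
Proof.
move=> irrY VY; apply: contrapT => noO.
pose bad (z : 'rV[K]_(n + n)) (w : 'rV[K]_n) := var_tangent_space Y (lsubmx z) w /\
  forall eta, ~ var_tangent_space V z (row_mx w eta).
pose W := [set z | V z /\ exists w, bad z w].
have dense O : zariski_open O -> Y `&` O !=set0 -> W `&` (lsubmx @^-1` O) !=set0.
  move=> oO YO; apply: contrapT => WO; apply: noO; exists O; split=> // z Vz Oz w Tw.
  apply: contrapT => /forallNP noeta; apply: WO; exists z; split=> //.
  by split=> //; exists w.
pose w (z : 'rV[K]_(n + n)) := xget 0 [set w | bad z w].
have badw z : W z -> bad z (w z) by move=> [_ bz]; apply: xgetPex.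
(* W is the set of bad points.  Its traces over the open sets that meet Y are
   non-empty, and stable under intersection since Y is irreducible. *)
pose basis := [set b | exists O,
  [/\ zariski_open O, Y `&` O !=set0 & b = W `&` (lsubmx @^-1` O)]].
have openT : zariski_open [set: 'rV[K]_n].
  rewrite (_ : setT = [set x : 'rV[K]_n | (1 : {mpoly K[n]}).@[x 0] != 0]).
    exact: open_nonzero_set.
  by apply/seteqP; split=> x //= _; rewrite meval1 oner_neq0.
have [||b c|U [F [cls [ultraU BU cls_surj cls0]]]] := @exists_ultra_class K _ basis.
- exists (W `&` (lsubmx @^-1` setT)), setT; split=> //.
  by have [[y Yy] _] := irrY; exists y.
- by move=> _ [O [oO YO ->]]; apply: dense.
- move=> [O [oO YO ->]] [O' [oO' YO' ->]].
  exists (W `&` (lsubmx @^-1` (O `&` O'))); last by move=> z [Wz [Oz Oz']]; split; split.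
  exists (O `&` O'); split=> //; first exact: zariski_openI.
  exact: irreducible_openI.
have UW : U W.
  have : U (W `&` (lsubmx @^-1` setT)).
    by apply: BU; exists setT; split=> //; have [[y Yy] _] := irrY; exists y.
  by apply: filterS => z [].
pose g (j : 'I_n) : {mpoly K[n + n]} := 'X_(lshift n j).
pose iota := const_class cls; pose zeta := class_point cls.
have gz j : mmap iota zeta (g j) = cls (fun z => z 0 (lshift n j)).
  by rewrite mmapX mmap1U.
(* The bad vectors form one tangent vector over F at a generic point of Y. *)
have tan_w : point_tangent iota (fun j => mmap iota zeta (g j))
    (fun j => cls (fun z => w z 0 j)).
  have -> : (fun j => mmap iota zeta (g j)) =
      cls \o (fun j (z : 'rV[K]_(n + n)) => lsubmx z 0 j).
    apply/funext => j; rewrite gz /=; congr (cls _); apply/funext => z; by rewrite mxE.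
  move=> f; rewrite mmap_cls => /cls0 Uf.
  have If : vanishing_ideal Y f.
    move=> y Yy; apply: contrapT => /eqP fy.
    have Uf' : U (W `&` (lsubmx @^-1` [set x : 'rV[K]_n | f.@[x 0] != 0])).
      apply: BU; exists [set x : 'rV[K]_n | f.@[x 0] != 0]; split=> //.
        exact: open_nonzero_set.
      by exists y.
    apply: (@filter_not_empty _ U); apply: filterS2 Uf Uf' => z /= fz [_] /=.
    by rewrite -fz => /negP; apply.
  rewrite (point_diff_cls cls _ (fun j z => w z 0 j) f); apply/cls0.
  apply: filterS UW => z Wz /=; have [Tw _] := badw z Wz; exact: Tw.
have [v [tan_v dgv]] := tangent_lift (const_class_pchar cls charK0) tan_w.
have [v' vE] := @boolp.choice _ _ (fun i f => cls f = v i) (fun i => cls_surj (v i)).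
have UI : U (zero_locus (vanishing_ideal V)).
  by apply: filterS UW => z [Vz _]; apply: zero_locus_vanishing.
have clsv : v = cls \o v' by apply/funext => i; rewrite /= vE.
rewrite clsv in tan_v.
have Utan := tangent_class ultraU cls0 (vanishing_ideal_ideal V) UI tan_v.
have Uw : U [set z | forall j, v' (lshift n j) z = w z 0 j].
  apply: filter_forall => j; have := dgv j; rewrite /g point_diffX -vE.
  move/eqP; rewrite -subr_eq0 -rmorphB => /eqP/cls0.
  by apply: filterS => z /= /eqP; rewrite subr_eq0 => /eqP.
have [z [[Wz Tz] wz]] := filter_ex (filterI (filterI UW Utan) Uw).
have [_ /(_ (\row_j v' (rshift n j) z))] := badw z Wz; apply.
suff -> : row_mx (w z) (\row_j v' (rshift n j) z) = \row_i v' i z by [].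
apply/rowP => i; rewrite !mxE; case: split_ordP => j ->; first by rewrite wz.
by rewrite mxE.
Qed.

(** * Jacobian matrices and tangent spaces *)

Section LinearAlgebra.
Variables (F : fieldType) (c r n : nat) (J : 'M[F]_(c, n)) (W : 'M[F]_(r, n)).
Hypotheses (freeJ : row_free J) (freeW : row_free W) (JW : J *m W^T = 0).

Lemma orthogonal_rank : (c + r <= n)%N.
Proof.
have /mxrankS : (J <= kermx W^T)%MS by apply/sub_kermxP.
rewrite mxrank_ker mxrank_tr (eqP freeJ) (eqP freeW) => cnr.
have rn : (r <= n)%N by rewrite -(eqP freeW) rank_leq_col.
by rewrite addnC -leq_subRL.
Qed.

(** By dimension, the rows of [J] span the orthogonal of [W]. *)
Lemma orthogonal_span (x : 'rV[F]_n) : (n <= c + r)%N -> x *m W^T = 0 -> (x <= J)%MS.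
Proof.
move=> ncr xW; have sJ : (J <= kermx W^T)%MS by apply/sub_kermxP.
have /leqifP := mxrank_leqif_sup sJ.
rewrite mxrank_ker mxrank_tr (eqP freeJ) (eqP freeW).
have xk : (x <= kermx W^T)%MS by apply/sub_kermxP.
case: ifP => [kJ _|_]; first exact: submx_trans kJ.
by rewrite ltn_subRL addnC ltnNge ncr.
Qed.
End LinearAlgebra.

Lemma dim_kernel (K : fieldType) c n (A : 'M[K]_(c, n)) (T : {vspace 'rV[K]_n}) :
  row_free A -> (forall v, v \in T <-> v *m A^T = 0) -> (\dim T = n - c)%N.
Proof.
move=> freeA TA; pose f := linfun (mulmxr A^T : 'rV[K]_n -> 'rV[K]_c).
have -> : T = lker f.
  apply/vspaceP => v; rewrite memv_ker lfunE /=.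
  by apply/idP/eqP => /TA.
have imf : limg f = fullv.
  apply/vspaceP => u; rewrite memvf; apply/memv_imgP.
  have : (u <= A^T)%MS by apply: submx_full; rewrite /row_full mxrank_tr; exact: freeA.
  by case/submxP => v ->; exists v; rewrite ?memvf // lfunE.
have := limg_ker_dim f fullv; rewrite imf capfv !dimvf /dim /= !mul1n => dimE.
by rewrite -[in RHS]dimE addnK.
Qed.

(** Independence of the rows of [J] at the point [x] is the non-vanishing of a
    polynomial [delta], the determinant of [J] times a constant right inverse of
    its value at [x].  Independence then holds wherever [delta] is not zero, at
    points over any field, and Cramer's formula gives the coefficients of a
    combination of the rows as polynomials divided by [delta]. *)
Lemma minor_witness (K : fieldType) n m c (J : 'M[{mpoly K[n]}]_(c, m))
    (x : {rmorphism {mpoly K[n]} -> K}) :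
  (forall a, x a%:MP = a) -> row_free (map_mx x J) ->
  exists delta (C : 'M[{mpoly K[n]}]_(m, c)), x delta != 0 /\
    forall (F : fieldType) (phi : {rmorphism {mpoly K[n]} -> F}),
      (forall u : 'rV[F]_m, (u <= map_mx phi J)%MS ->
         phi delta *: u = u *m map_mx phi C *m map_mx phi J) /\
      (phi delta != 0 -> row_free (map_mx phi J)).
Proof.
move=> xC /row_freeP[B JB].
pose B' := map_mx (@mpolyC n K) B; pose D := J *m B'.
have DB : map_mx x D = 1%:M.
  rewrite map_mxM -map_mx_comp -[RHS]JB; congr (_ *m _).
  by apply/matrixP => i j; rewrite !mxE /= xC.
exists (\det D), (B' *m \adj D); split.
  by rewrite -det_map_mx DB det1 oner_neq0.
move=> F phi; split=> [u /submxP[a ->]|dN0].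
  rewrite map_mxM -!mulmxA (mulmxA _ (map_mx phi B')) -map_mxM.
  rewrite (mulmxA (map_mx phi D)) -map_mxM mul_mx_adj map_scalar_mx mul_scalar_mx.
  by rewrite -scalemxAr.
have uD : map_mx phi D \in unitmx by rewrite unitmxE det_map_mx unitfE.
apply/row_freeP; exists (map_mx phi B' *m invmx (map_mx phi D)).
by rewrite mulmxA -map_mxM mulmxV.
Qed.

Definition jacobian (K : comNzRingType) n c (f : 'I_c -> {mpoly K[n]}) :
  'M[{mpoly K[n]}]_(c, n) := \matrix_(j, i) (f j)^`M(i).

Definition gradient (K : comNzRingType) n (u : {mpoly K[n]}) (x : 'rV[K]_n) : 'rV[K]_n :=
  \row_i (u^`M(i)).@[x 0].

(** A maximal independent family of gradients of elements of [I]. *)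
Lemma independent_gradients (K : closedFieldType) n (I : set {mpoly K[n]})
    (x : 'rV[K]_n) :
  exists c (f : 'I_c -> {mpoly K[n]}),
    [/\ forall j, I (f j), row_free (map_mx (meval (x 0)) (jacobian f)) &
        forall u, I u -> (gradient u x <= map_mx (meval (x 0)) (jacobian f))%MS].
Proof.
pose P c := `[< exists f : 'I_c -> {mpoly K[n]}, (forall j, I (f j)) /\
   row_free (map_mx (meval (x 0)) (jacobian f)) >].
have P0 : exists c, P c.
  exists 0%N; apply/asboolP; exists (fun=> 0); split=> [[]//|].
  by rewrite /row_free -leqn0 rank_leq_row.
have Pn c : P c -> (c <= n)%N.
  by move=> /asboolP[f [_ /eqP <-]]; rewrite rank_leq_col.
case: (ex_maxnP P0 Pn) => c /asboolP[f [If free_f]] maxc.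
exists c, f; split=> // u Iu; apply: contrapT => /negP nu.
pose f' (i : 'I_(c + 1)) := match fintype.split i with inl j => f j | inr _ => u end.
suff : P (c + 1)%N by move/maxc; rewrite addn1 ltnn.
apply/asboolP; exists f'; split=> [i|]; first by rewrite /f'; case: (fintype.split i) => j.
have -> : map_mx (meval (x 0)) (jacobian f') =
   col_mx (map_mx (meval (x 0)) (jacobian f)) (gradient u x).
  apply/matrixP => i j; rewrite !mxE /f'; case: splitP => k _; rewrite !mxE //.
set A := map_mx _ _ in free_f nu *; rewrite /row_free -addsmxE.
rewrite eqn_leq; apply/andP; split.
  apply: leq_trans (mxrank_adds_leqif _ _) _.
  by rewrite (eqP free_f) leq_add2l rank_leq_row.
rewrite addn1 -[c in (c < _)%N](eqP free_f); apply: rank_ltmx.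
by rewrite ltmxE addsmxSl addsmx_sub submx_refl.
Qed.

Lemma pairing_mulmx (K : closedFieldType) n (v xi : 'rV[K]_n) :
  pairing v xi = (v *m xi^T) 0 0.
Proof. by rewrite mxE; apply: eq_bigr => i _; rewrite mxE. Qed.

Lemma pairingC (K : closedFieldType) n (v xi : 'rV[K]_n) : pairing v xi = pairing xi v.
Proof. by apply: eq_bigr => i _; rewrite mulrC. Qed.

Lemma tangent_spaceP (K : closedFieldType) n (I : set {mpoly K[n]}) (x v : 'rV[K]_n) :
  tangent_space I x v <-> forall f, I f -> pairing (gradient f x) v = 0.
Proof.
by split=> Tv f If; rewrite -[RHS](Tv f If); apply: eq_bigr => i _; rewrite mxE.
Qed.

Section TangentEquations.
Variables (K : closedFieldType) (n : nat) (I : set {mpoly K[n]}) (x : 'rV[K]_n).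
Variables (c : nat) (f : 'I_c -> {mpoly K[n]}).
Let A := map_mx (meval (x 0)) (jacobian f).
Hypothesis If : forall j, I (f j).
Hypothesis freeA : row_free A.
Hypothesis spanA : forall u, I u -> (gradient u x <= A)%MS.

Lemma row_jacobian j : row j A = gradient (f j) x.
Proof. by apply/rowP => i; rewrite !mxE. Qed.

Lemma tangent_space_kernel v : tangent_space I x v <-> v *m A^T = 0.
Proof.
rewrite tangent_spaceP; split=> [Tv|vA u Iu]; last first.
  have /submxP[a ->] := spanA Iu.
  by rewrite pairing_mulmx -mulmxA -[A]trmxK -trmx_mul vA trmx0 mulmx0 mxE.
apply/rowP => j; transitivity (pairing v (gradient (f j) x)); last first.
  by rewrite pairingC [RHS]mxE Tv.
by rewrite mxE; apply: eq_bigr => i _; rewrite !mxE.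
Qed.

(** The gradients at [x] of the elements of [I] form a linear space, so it is its
    own bi-orthogonal. *)
Lemma annihilator_gradient xi : is_ideal I -> annihilator (tangent_space I x) xi ->
  exists2 u, I u & xi = gradient u x.
Proof.
move=> [I0 ID IM] annxi.
pose W := row_base (kermx A^T).
have W0 : W *m A^T = 0 by apply/sub_kermxP; rewrite eq_row_base.
have WA : A *m W^T = 0 by apply: trmx_inj; rewrite trmx_mul trmxK W0 trmx0.
have : xi *m W^T = 0.
  apply/rowP => j; have : tangent_space I x (row j W).
    by apply/tangent_space_kernel; rewrite -row_mul W0 row0.
  move/annxi => rowxi; transitivity (pairing xi (row j W)).
    by rewrite mxE; apply: eq_bigr => i _; rewrite !mxE.
  by rewrite pairingC rowxi mxE.
move=> xiW; have /submxP[a ->] : (xi <= A)%MS.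
  apply: (orthogonal_span freeA (row_base_free _) WA) => //.
  by rewrite mxrank_ker mxrank_tr (eqP freeA) -maxnE leq_maxr.
exists (\sum_j (a 0 j)%:MP * f j).
  by elim/big_ind: _ => // j _; apply: IM.
apply/rowP => i; rewrite !mxE (raddf_sum (mderiv i)) (raddf_sum (meval (x 0))) /=.
apply: eq_bigr => j _.
by rewrite mderiv_mulC mevalM mevalC !mxE.
Qed.

End TangentEquations.

(** * Dimension, algebraic independence and tangent vectors *)

Definition prime_ideal (A : comNzRingType) (P : set A) :=
  [/\ is_ideal P, ~ P 1 & forall a b, P (a * b) -> P a \/ P b].

Section AlgebraicIndependence.
Variables (K : fieldType) (n : nat).
Implicit Types (P : set {mpoly K[n]}).

Definition alg_independent P r (g : 'I_r -> {mpoly K[n]}) :=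
  forall H : {mpoly K[r]}, P (mmap (@mpolyC n K) g H) -> H = 0.

(** In a relation of minimal degree in [f] modulo the prime [P], the constant
    coefficient is not in [P], as one could divide by [f].  But it lies in [P'],
    since [f] does, which contradicts independence modulo [P']. *)
Lemma alg_independent_extend P P' r (g : 'I_r -> {mpoly K[n]}) f :
  prime_ideal P -> is_ideal P' -> P `<=` P' -> P' f -> ~ P f -> alg_independent P' g ->
  alg_independent P (fun i : 'I_r.+1 => oapp g f (unlift ord_max i)).
Proof.
move=> [idP P1 PM] [P'0 P'D P'M] PP' P'f Pf indg H.
set g' := fun i => _; have [p <-] := last_var_eval_surj H.
pose G := mmap (@mpolyC n K) g'.
have GC c : G (last_var_eval c%:P) = mmap (@mpolyC n K) g c.
  rewrite last_var_evalC /G (rmorph_mmap _ (mmap (@mpolyC n K) g')).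
  have -> : mmap (@mpolyC n K) g' \o @mpolyC r.+1 K = @mpolyC n K.
    by apply/funext => a /=; rewrite mmapC.
  congr (mmap _ _ c); apply/funext => i /=; rewrite mmapX mmap1U /g'.
  have -> : widen_ord (leqnSn r) i = lift ord_max i.
    by apply: val_inj; rewrite /= /bump leqNgt ltn_ord.
  by rewrite liftK.
have GX : G (last_var_eval 'X) = f.
  by rewrite last_var_evalX /G mmapX mmap1U /g' unlift_none.
change (P (G (last_var_eval p)) -> last_var_eval p = 0) => PG.
suff p0 : p = 0; first by rewrite p0 raddf0.
elim/poly_ind: p PG => // p c IH.
rewrite rmorphD rmorphM /= /G rmorphD rmorphM /= -!/(G _) GX GC => PG.
have c0 : c = 0.
  apply: indg; rewrite -[X in P' X](addKr (G (last_var_eval p) * f)).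
  apply: P'D; last exact: PP'.
  by rewrite -mulNr; apply: P'M.
rewrite c0 rmorph0 addr0 in PG.
have [/IH ->|/Pf //] := PM _ _ PG.
by rewrite mul0r add0r c0.
Qed.

Lemma chain_alg_independent (P : nat -> set {mpoly K[n]}) r :
  (forall i, (i <= r)%N -> prime_ideal (P i)) ->
  (forall i, (i < r)%N -> P i.+1 `<` P i) ->
  exists g : 'I_r -> {mpoly K[n]}, alg_independent (P r) g.
Proof.
elim: r => [|r IH] primeP chainP.
  exists (fun=> 0) => H; have [[_ _ PM] P1 _] := primeP 0%N isT.
  have [a ->] : exists a, H = a%:MP.
    elim/mpoly_ring_ind: H => [c|[]//|_ _ [p ->] [q ->]|_ _ [p ->] [q ->]].
    - by exists c.
    - by exists (p + q); rewrite mpolyCD.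
    - by exists (p * q); rewrite mpolyCM.
  rewrite mmapC => Pa; apply/eqP; rewrite mpolyC_eq0; apply/negPn/negP => aN0.
  by apply: P1; have := PM (a^-1)%:MP _ Pa; rewrite -mpolyCM mulVf // mpolyC1.
have [i ir|i ir|g indg] := IH.
- by apply: primeP; apply: leqW.
- by apply: chainP; apply: leqW.
have [PP' /existsNP[f /not_implyP[P'f Pf]]] := chainP r (ltnSn r).
exists (fun i => oapp g f (unlift ord_max i)).
apply: (alg_independent_extend _ _ PP') => //; first exact: primeP.
by have [] := primeP r (leqnSn r).
Qed.

End AlgebraicIndependence.

(** Every prescription of derivatives for the [g j] is realised by a tangent
    vector, since there is no relation to be respected; the dual basis gives
    [W]. *)
Lemma tangent_vectors (K F : fieldType) (charF0 : [pchar F] =i pred0)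
    (iota : {rmorphism K -> F}) n (zeta : 'I_n -> F) r (g : 'I_r -> {mpoly K[n]}) :
  alg_independent [set f | mmap iota zeta f = 0] g ->
  exists W : 'M[F]_(r, n), row_free W /\
    forall l, point_tangent iota zeta (W l).
Proof.
move=> indg; have lift_delta l : exists v, point_tangent iota zeta v /\
    forall j, point_diff iota zeta v (g j) = (j == l)%:R.
  apply: tangent_lift => // f f0.
  have -> : f = 0.
    apply: indg; rewrite /= rmorph_mmap -[RHS]f0; congr (mmap _ _ f).
    by apply/funext => c /=; exact: mmapC.
  rewrite /point_diff big1 // => i _; by rewrite mderiv0 rmorph0 mul0r.
have [w wP] := boolp.choice lift_delta.
exists (\matrix_(l, i) w l i); split; last first.
  move=> l; have [tan_w _] := wP l.
  by have -> : (\matrix_(l, i) w l i) l = w l; [apply/funext => i; rewrite mxE|].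
apply/row_freeP; exists (\matrix_(i, j) mmap iota zeta (g j)^`M(i)).
apply/matrixP => l j; rewrite !mxE; have [_ /(_ j)] := wP l.
by rewrite eq_sym => <-; apply: eq_bigr => i _; rewrite !mxE mulrC.
Qed.

(** A generic point of [Z], with an ultrafilter on [Z] that allows to specialise
    vectors at this point to points of [Z]. *)
Lemma exists_generic_class (K : closedFieldType) m (Z : set 'rV[K]_m) :
  prime_ideal (vanishing_ideal Z) ->
  exists (U : set_system 'rV[K]_m) (F : fieldType)
         (cls : {rmorphism ('rV[K]_m -> K) -> F}),
    [/\ UltraFilter U, U Z, forall u, exists f, cls f = u,
        forall f, cls f = 0 <-> U [set z | f z = 0] &
        forall f, mmap (const_class cls) (class_point cls) f = 0 <-> vanishing_ideal Z f].
Proof.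
move=> [_ I1 IM].
pose basis := [set b | exists2 f : {mpoly K[m]}, ~ vanishing_ideal Z f &
  b = [set z | Z z /\ f.@[z 0] != 0]].
have [||b c|U [F [cls [ultraU BU cls_surj cls0]]]] := @exists_ultra_class K _ basis.
- by exists [set z | Z z /\ (1 : {mpoly K[m]}).@[z 0] != 0], 1.
- by move=> _ [f /existsNP[z /not_implyP[Zz /eqP fz]] ->]; exists z.
- move=> [f If ->] [g Ig ->].
  exists [set z | Z z /\ (f * g).@[z 0] != 0]; first by exists (f * g) => // /IM[].
  by move=> z [Zz]; rewrite mevalM mulf_eq0 negb_or => /andP[].
exists U, F, cls.
have UZ : U Z.
  have : U [set z | Z z /\ (1 : {mpoly K[m]}).@[z 0] != 0] by apply: BU; exists 1.
  by apply: filterS => z [].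
split=> // f; rewrite mmap_class_point cls0; split=> [Uf|If]; last first.
  by apply: filterS UZ => z /If.
apply: contrapT => nIf.
have Uf' : U [set z | Z z /\ f.@[z 0] != 0] by apply: BU; exists f.
by apply: (@filter_not_empty _ U); apply: filterS2 Uf Uf' => z /= -> [_ /eqP].
Qed.

Lemma irreducible_prime (K : closedFieldType) n (Z : set 'rV[K]_n) :
  irreducible_set Z -> prime_ideal (vanishing_ideal Z).
Proof.
move=> [[z Zz] irrZ]; split; first exact: vanishing_ideal_ideal.
  by move=> /(_ z Zz) /eqP; rewrite meval1 oner_eq0.
move=> f g Ifg; have [|Zf|Zg] := irrZ _ _ (closed_zero_set f) (closed_zero_set g).
- by move=> x /Ifg /eqP; rewrite mevalM mulf_eq0 => /orP[]/eqP; [left|right].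
- by left.
- by right.
Qed.

Lemma vanishing_ideal_proper (K : closedFieldType) n (A B : set 'rV[K]_n) :
  zariski_closed A -> A `<` B -> vanishing_ideal B `<` vanishing_ideal A.
Proof.
move=> [J ->] [AB BA]; split=> [f If x /AB /If //|IAB].
apply: BA => x Bx f Jf; apply: IAB => // y; exact.
Qed.

(** Jacobian ranks do not exceed the codimension, at any point of [X]:
    independence at [x] spreads to the generic point, where there are [d]
    independent tangent vectors. *)
Lemma chain_rank_bound (K : closedFieldType) (charK0 : [pchar K] =i pred0) n
    (X : set 'rV[K]_n) d C c (f : 'I_c -> {mpoly K[n]}) (x : 'rV[K]_n) :
  irreducible_set X -> irreducible_chain X d C -> X x ->
  (forall j, vanishing_ideal X (f j)) ->
  row_free (map_mx (meval (x 0)) (jacobian f)) -> (c + d <= n)%N.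
Proof.
move=> irrX [irrC strictC] Xx If freeJ.
have primeI := irreducible_prime irrX.
have [U [F [cls [ultraU UX cls_surj cls0 genX]]]] := exists_generic_class primeI.
have [|i id|g indg] := @chain_alg_independent K n (fun i => vanishing_ideal (C i)) d.
- by move=> i id; have [_ irrCi _] := irrC i id; apply: irreducible_prime.
- have [clC _ _] := irrC i (ltnW id).
  by apply: vanishing_ideal_proper (strictC i id).
have [_ _ CX] := irrC d (leqnn d).
have [|W [freeW tanW]] := @tangent_vectors K F (const_class_pchar cls charK0)
  (const_class cls) n (class_point cls) d g.
  by move=> H /= /genX IH; apply: indg => z /CX /IH.
have [delta [B [deltax deltaP]]] := minor_witness (mevalC (x 0)) freeJ.
have [_ freeJF] := deltaP F (mmap (const_class cls) (class_point cls)).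
apply: (orthogonal_rank (freeJF _) freeW).
  by apply/eqP => /genX /(_ x Xx) /eqP; apply/negP.
apply/matrixP => j l; rewrite !mxE.
have fj0 : mmap (const_class cls) (class_point cls) (f j) = 0 by apply/genX; apply: If.
rewrite -[RHS](tanW l _ fj0); apply: eq_bigr => i _; by rewrite !mxE.
Qed.

Lemma smooth_codim (K : closedFieldType) n (V : set 'rV[K]_n) x : smooth_locus V x ->
  exists c (f : 'I_c -> {mpoly K[n]}) d,
    [/\ forall j, vanishing_ideal V (f j),
        row_free (map_mx (meval (x 0)) (jacobian f)),
        forall u, vanishing_ideal V u ->
          (gradient u x <= map_mx (meval (x 0)) (jacobian f))%MS,
        has_dimension V d & (c + d = n)%N].
Proof.
move=> [Vx [T [TV dimT]]].
have [c [f [If freeJ spanJ]]] := independent_gradients (vanishing_ideal V) x.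
exists c, f, (\dim T); split=> //.
rewrite (dim_kernel (T := T) freeJ) => [|v].
  by rewrite subnKC // -(eqP freeJ) rank_leq_col.
rewrite -(tangent_space_kernel If spanJ).
by have -> : tangent_space (vanishing_ideal V) x = [set v | v \in T].
Qed.

Lemma codim_smooth (K : closedFieldType) n (V : set 'rV[K]_n) x c
    (f : 'I_c -> {mpoly K[n]}) d :
  V x -> (forall j, vanishing_ideal V (f j)) ->
  row_free (map_mx (meval (x 0)) (jacobian f)) ->
  (forall u, vanishing_ideal V u ->
          (gradient u x <= map_mx (meval (x 0)) (jacobian f))%MS) ->
  has_dimension V d -> (c + d = n)%N -> smooth_locus V x.
Proof.
move=> Vx If freeJ spanJ dimV cdn; split=> //; set A := map_mx _ _ in freeJ spanJ.
pose T := lker (linfun (mulmxr A^T : 'rV[K]_n -> 'rV[K]_c)).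
have TE v : v \in T <-> v *m A^T = 0.
  by rewrite memv_ker lfunE /=; split=> [/eqP|->].
exists T; split.
  by apply/seteqP; split=> v; rewrite /= ?TE; move/(tangent_space_kernel If spanJ).
rewrite (dim_kernel freeJ TE); have -> // : (n - c)%N = d.
by rewrite -cdn addKn.
Qed.

Lemma meval_mmap (K : comNzRingType) n m (s : 'I_n -> {mpoly K[m]}) (x : 'I_m -> K)
    (f : {mpoly K[n]}) :
  (mmap (@mpolyC m K) s f).@[x] = f.@[fun j => (s j).@[x]].
Proof.
rewrite (rmorph_mmap _ (meval x)) /meval; congr (mmap _ _ f).
by apply/funext => c /=; rewrite mevalC.
Qed.

(** * Lines and cones *)

Section Lines.
Variables (K : closedFieldType) (n : nat).
Implicit Types (f : {mpoly K[n]}) (x u : 'rV[K]_n).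

Definition line_poly f x u : {poly K} :=
  mmap (@polyC K) (fun i => (x 0 i)%:P + (u 0 i)%:P * 'X) f.

Lemma line_polyE f x u t : (line_poly f x u).[t] = f.@[(x + t *: u) 0].
Proof.
rewrite -[_.[t]]/(horner_eval t _) rmorph_mmap /meval /=.
have -> : horner_eval t \o polyC = idfun.
  by apply/funext => c /=; rewrite /horner_eval hornerC.
congr (mmap _ _ f); apply/funext => i /=.
by rewrite /horner_eval hornerD hornerMX !hornerC !mxE mulrC.
Qed.

Lemma horner_deriv_derivation (t : K) :
  derivation_over (horner_eval t) (fun p => p^`().[t]).
Proof.
split=> p q; rewrite ?derivD ?hornerD // derivM hornerD !hornerM /horner_eval.
by rewrite addrC [X in _ + X]mulrC.
Qed.

Lemma line_poly_deriv f x u t :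
  (line_poly f x u)^`().[t] = pairing (gradient f (x + t *: u)) u.
Proof.
rewrite (derivation_mmap _ _ (horner_deriv_derivation t)); last first.
  by move=> c; rewrite derivC horner0.
apply: eq_bigr => i _; rewrite mxE.
congr (_ * _); first exact: line_polyE.
by rewrite derivD !derivC add0r derivM derivC derivX mul0r mulr1 add0r hornerC.
Qed.

Lemma exists_common_nonroot (p q : {poly K}) : p != 0 -> q != 0 ->
  exists t, p.[t] != 0 /\ q.[t] != 0.
Proof.
move=> p0 q0; have /closed_nonrootP[t] : p * q != 0 by rewrite mulf_neq0.
by rewrite rootE hornerM mulf_eq0 negb_or => /andP[]; exists t.
Qed.

End Lines.

Lemma dhomog_scale (K : comNzRingType) n d (f : {mpoly K[n]}) (lambda : K) (x : 'rV[K]_n) :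
  f \is d.-homog -> f.@[(lambda *: x) 0] = lambda ^+ d * f.@[x 0].
Proof.
move=> /dhomogP homf; rewrite !mevalE big_distrr /= !big_seq.
apply: eq_bigr => m /homf dm; rewrite mulrCA; congr (_ * _).
have -> : d = \sum_i m i by rewrite -mdegE.
rewrite -prodrXr -big_split /=; apply: eq_bigr => i _.
by rewrite mxE exprMn.
Qed.

Section Cones.
Variables (K : closedFieldType) (N : nat).
Implicit Types (V : set 'rV[K]_N.+1).

Lemma homogeneous_closed_scale V x (lambda : K) :
  homogeneous_closed V -> V x -> V (lambda *: x).
Proof.
move=> [J [homJ ->]] Vx f Jf; have [d homf] := homJ f Jf.
by rewrite (dhomog_scale _ _ homf) Vx // mulr0.
Qed.

Lemma scale_line_poly n (f : {mpoly K[n]}) (x : 'rV[K]_n) t :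
  (line_poly f 0 x).[t] = f.@[(t *: x) 0].
Proof. by rewrite line_polyE add0r. Qed.

(** [f (t *: x)] is a polynomial in [t] whose coefficients are the values at [x]
    of the homogeneous components of [f]. *)
Lemma line_part_homogeneous V :
  zariski_closed V -> homogeneous_closed [set x | forall t : K, V (t *: x)].
Proof.
move=> [J ->]; exists [set h | exists f d, J f /\ h = pihomog mdeg d f].
split=> [_ [f [d [_ ->]]]|]; first by exists d; apply: pihomogP.
have evalE (f : {mpoly K[N.+1]}) (t : K) (x : 'rV[K]_N.+1) : f.@[(t *: x) 0] =
    (\poly_(d < mmeasure mdeg f) (pihomog mdeg d f).@[x 0]).[t].
  rewrite horner_poly [in LHS](pihomog_partitionE (mf := mdeg) (p := f) (leqnn _)) raddf_sum.
  by apply: eq_bigr => d _ /=; rewrite (dhomog_scale _ _ (pihomogP _ _ _)) mulrC.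
apply/seteqP; split=> x Hx; last first.
  move=> t f Jf; rewrite evalE horner_poly big1 // => d _.
  by rewrite Hx ?mul0r //; exists f, d.
move=> _ [f [d [Jf ->]]].
have p0 : \poly_(d < mmeasure mdeg f) (pihomog mdeg d f).@[x 0] = 0.
  apply: contrapT => /eqP /closed_nonrootP[t]; rewrite rootE -evalE.
  by rewrite Hx ?eqxx.
have [df|fd] := ltnP d (mmeasure mdeg f).
  by have := congr1 (fun p : {poly K} => p`_d) p0; rewrite coef_poly df coef0.
have -> : pihomog mdeg d f = 0; last by rewrite meval0.
have := pihomog_partitionE (mf := mdeg) (leqnn (mmeasure mdeg f)) => fE.
rewrite [in LHS]fE raddf_sum big1 // => i _ /=.
apply: pihomog_ne0 (pihomogP mdeg i f).
by rewrite neq_ltn (leq_trans (ltn_ord i) fd).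
Qed.

(** Irreducibility for the Zariski topology of projective space implies
    irreducibility of the cone: each line of the cone is irreducible, so it lies
    in one of the two closed sets, and the union of the lines contained in a
    closed set is homogeneous closed. *)
Lemma cone_irreducible V : cone_over_projective_variety V -> irreducible_set V.
Proof.
move=> [homV [x [Vx _]] irrV]; split; first by exists x.
move=> A B clA clB VAB.
have [y Vy||] := irrV _ _ (line_part_homogeneous clA) (line_part_homogeneous clB).
- apply: contrapT => /not_orP[/existsNP[s As] /existsNP[t Bt]].
  have [J AE] := clA; have [L BE] := clB; move: As Bt; rewrite AE BE.
  move=> /existsNP[f /not_implyP[Jf /eqP fs]] /existsNP[g /not_implyP[Lg /eqP gt]].
  have pf : line_poly f 0 y != 0.
    by apply: contra_neq fs => p0; rewrite -scale_line_poly p0 horner0.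
  have pg : line_poly g 0 y != 0.
    by apply: contra_neq gt => p0; rewrite -scale_line_poly p0 horner0.
  have [r [fr gr]] := exists_common_nonroot pf pg.
  have := VAB _ (homogeneous_closed_scale r homV Vy).
  rewrite AE BE => -[/(_ f Jf)|/(_ g Lg)] /eqP; rewrite -scale_line_poly; exact/negP.
- by move=> VA; left=> y /VA /(_ 1); rewrite scale1r.
- by move=> VB; right=> y /VB /(_ 1); rewrite scale1r.
Qed.

(** Euler's relation, on the line through [x]. *)
Lemma euler_tangent V x f :
  homogeneous_closed V -> V x -> vanishing_ideal V f -> pairing (gradient f x) x = 0.
Proof.
move=> homV Vx If; have p0 : line_poly f 0 x = 0.
  apply: contrapT => /eqP /closed_nonrootP[t]; rewrite rootE scale_line_poly.
  by rewrite If ?eqxx //; apply: homogeneous_closed_scale.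
have := line_poly_deriv f 0 x 1; rewrite p0 deriv0 horner0 scale1r add0r => <- //.
Qed.

(** Restriction to the affine hyperplane where the coordinate [i] has the value
    [lambda]. *)
Definition chart_subst (i : 'I_N.+1) (lambda : K) (h : {mpoly K[N.+1]}) : {mpoly K[N]} :=
  mmap (@mpolyC N K) (fun j => lambda%:MP * oapp (fun k => 'X_k) 1 (unlift i j)) h.

Lemma chart_substE i lambda h (b : 'rV[K]_N) :
  (chart_subst i lambda h).@[b 0] = h.@[(lambda *: chart_point i b) 0].
Proof.
rewrite meval_mmap; apply: meval_eq => j; rewrite !mxE mevalM mevalC; congr (_ * _).
by case: (unlift i j) => [k|] /=; rewrite ?mevalXU ?meval1.
Qed.

Lemma chart_subst_deriv i h (k : 'I_N) :
  (chart_subst i 1 h)^`M(k) = chart_subst i 1 h^`M(lift i k).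
Proof.
have der : derivation_over idfun (@mderiv N K k).
  by split=> p q; rewrite ?mderivD // mderivM /= addrC [X in _ + X]mulrC.
have := derivation_mmap (fun j => 1%:MP * oapp (fun k => 'X_k) 1 (unlift i j)) h der
  (k := @mpolyC N K) (mderivC k).
rewrite /chart_subst => ->; rewrite (bigD1 (lift i k)) //= big1 ?addr0 => [|j jk].
  by rewrite liftK /= mul1r mderivXU eqxx mulr1.
case: unliftP jk => [l ->|->] /=; last by rewrite mul1r -mpolyC1 mderivC mulr0.
rewrite (inj_eq lift_inj) => lk.
by rewrite mpolyC1 mul1r mderivXU eq_sym (negPf lk) mulr0.
Qed.

(** The degree is chosen larger than that of [f], so that [h] also vanishes on
    the hyperplane at infinity of the chart. *)
Lemma exists_homogenization i (f : {mpoly K[N]}) :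
  exists D (h : {mpoly K[N.+1]}), [/\ h \is D.-homog, chart_subst i 1 h = f &
    forall xi : 'rV[K]_N.+1, xi 0 i = 0 -> h.@[xi 0] = 0].
Proof.
have substX : chart_subst i 1 'X_i = 1.
  by rewrite /chart_subst mmapX mmap1U unlift_none /= mulr1 mpolyC1.
have homX j : ('X_j : {mpoly K[N.+1]}) \is 1.-homog by rewrite dhomogX /= mdeg1.
have homXn e : ('X_i ^+ e : {mpoly K[N.+1]}) \is e.-homog.
  by have := dhomogMn e (homX i); rewrite mul1n.
elim/mpoly_ring_ind: f => [c|k|_ _ [D [h [homh <- h0]]] [E [g [homg <- g0]]]
                         |_ _ [D [h [homh <- h0]]] [E [g [homg <- g0]]]].
(* Already constants are multiplied by the equation of that hyperplane. *)
- exists 1%N, (c%:MP * 'X_i); split=> [||xi xi0].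
  + by rewrite mul_mpolyC; apply: dhomogZ.
  + by rewrite /chart_subst rmorphM /= mmapC -/(chart_subst _ _ _) substX mulr1.
  + by rewrite mevalM mevalXU xi0 mulr0.
- exists 2%N, ('X_(lift i k) * 'X_i); split=> [||xi xi0].
  + exact: (dhomogM (homX (lift i k)) (homX i)).
  + rewrite /chart_subst rmorphM /= -!/(chart_subst _ _ _) substX mulr1.
    by rewrite /chart_subst mmapX mmap1U liftK /= mpolyC1 mul1r.
  + by rewrite mevalM !mevalXU xi0 mulr0.
- exists (D + E)%N, (h * 'X_i ^+ E + g * 'X_i ^+ D); split=> [||xi xi0].
  + apply: rpredD; first exact: (dhomogM homh (homXn E)).
    by rewrite addnC; exact: (dhomogM homg (homXn D)).
  + rewrite /chart_subst rmorphD !rmorphM !rmorphXn /= -!/(chart_subst _ _ _) substX.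
    by rewrite !expr1n !mulr1.
  + by rewrite mevalD !mevalM h0 // g0 // !mul0r addr0.
- exists (D + E)%N, (h * g); split=> [||xi xi0]; first exact: (dhomogM homh homg).
    by rewrite /chart_subst rmorphM.
  by rewrite mevalM h0 // mul0r.
Qed.

End Cones.

(** * Isotropic tangent spaces in a product with the dual *)

Section Differentials.
Variables (K : closedFieldType).

Lemma pairing_gradient_derivation n (z t : 'rV[K]_n) :
  derivation_over (meval (z 0)) (fun f => pairing (gradient f z) t).
Proof.
have [dD dM] := point_diff_derivation idfun (z 0) (t 0).
have E f : pairing (gradient f z) t = point_diff idfun (z 0) (t 0) f.
  by apply: eq_bigr => i _; rewrite mxE.
by split=> f g; rewrite !E ?dD ?dM.
Qed.

Lemma pairing_gradientX n (z t : 'rV[K]_n) i : pairing (gradient 'X_i z) t = t 0 i.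
Proof.
rewrite /pairing (bigD1 i) //= big1 => [|j ji]; rewrite mxE mderivXU.
  by rewrite eqxx meval1 mul1r addr0.
by rewrite (negPf ji) meval0 mul0r.
Qed.

Lemma pairing_gradientC n (z t : 'rV[K]_n) c : pairing (gradient c%:MP z) t = 0.
Proof. by rewrite /pairing big1 // => i _; rewrite mxE mderivC meval0 mul0r. Qed.

Lemma gradient_subst n m (s : 'I_n -> {mpoly K[m]}) (f : {mpoly K[n]}) (z t : 'rV[K]_m) :
  pairing (gradient (mmap (@mpolyC m K) s f) z) t =
  \sum_(j < n) (f^`M(j)).@[fun i => (s i).@[z 0]] * pairing (gradient (s j) z) t.
Proof.
rewrite (derivation_mmap _ _ (pairing_gradient_derivation z t)).
  by apply: eq_bigr => j _ /=; rewrite meval_mmap.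
exact: pairing_gradientC.
Qed.

Variable n : nat.

Definition pull_left : {mpoly K[n]} -> {mpoly K[n + n]} :=
  mmap (@mpolyC (n + n) K) (fun i => 'X_(lshift n i)).
Definition pull_right : {mpoly K[n]} -> {mpoly K[n + n]} :=
  mmap (@mpolyC (n + n) K) (fun i => 'X_(rshift n i)).

Lemma pull_leftE f (z : 'rV[K]_(n + n)) : (pull_left f).@[z 0] = f.@[lsubmx z 0].
Proof. by rewrite meval_mmap; apply: meval_eq => i; rewrite mevalXU mxE. Qed.

Lemma pull_rightE f (z : 'rV[K]_(n + n)) : (pull_right f).@[z 0] = f.@[rsubmx z 0].
Proof. by rewrite meval_mmap; apply: meval_eq => i; rewrite mevalXU mxE. Qed.

Lemma pull_left_diff f (z t : 'rV[K]_(n + n)) :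
  pairing (gradient (pull_left f) z) t = pairing (gradient f (lsubmx z)) (lsubmx t).
Proof.
rewrite gradient_subst; apply: eq_bigr => i _; rewrite pairing_gradientX !mxE.
by congr (_ * _); apply: meval_eq => j; rewrite mevalXU mxE.
Qed.

Lemma pull_right_diff f (z t : 'rV[K]_(n + n)) :
  pairing (gradient (pull_right f) z) t = pairing (gradient f (rsubmx z)) (rsubmx t).
Proof.
rewrite gradient_subst; apply: eq_bigr => i _; rewrite pairing_gradientX !mxE.
by congr (_ * _); apply: meval_eq => j; rewrite mevalXU mxE.
Qed.

(** Put z = (x, xi).  The equations say that [delta] times x is the combination of
    the gradients of the [h j] at xi with coefficients [M j].  Differentiate
    them along [t1] = (a, b) and pair with the right component b' of [t2].
    As b' is orthogonal to these gradients, hence to x, only [delta] times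
    <a, b'> and the value at (b, b') of a combination [S] of the Hessians of
    the [h j] remain.  Since [S] is symmetric, <a, b'> = <a', b>. *)
Lemma isotropic_tangent c (h : 'I_c -> {mpoly K[n]}) (delta : {mpoly K[n + n]})
    (M : 'I_c -> {mpoly K[n + n]}) (I : set {mpoly K[n + n]}) (z : 'rV[K]_(n + n)) :
  zero_locus I z -> (forall j, I (pull_right (h j))) ->
  (forall k, I (delta * 'X_(lshift n k) - \sum_j M j * pull_right (h j)^`M(k))) ->
  delta.@[z 0] != 0 ->
  forall t1 t2, tangent_space I z t1 -> tangent_space I z t2 ->
    pairing (lsubmx t1) (rsubmx t2) = pairing (lsubmx t2) (rsubmx t1).
Proof.
move=> zI hI GI dN0 t1 t2 /tangent_spaceP T1 /tangent_spaceP T2.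
pose y := lsubmx z; pose xi := rsubmx z.
pose S (b b' : 'rV[K]_n) := \sum_j (M j).@[z 0] *
  \sum_k \sum_l ((h j)^`M(k)^`M(l)).@[xi 0] * b 0 l * b' 0 k.
have ortho t : (forall f, I f -> pairing (gradient f z) t = 0) ->
    forall j, pairing (gradient (h j) xi) (rsubmx t) = 0.
  by move=> Tt j; rewrite -pull_right_diff; apply: Tt.
have yE k : delta.@[z 0] * y 0 k = \sum_j (M j).@[z 0] * gradient (h j) xi 0 k.
  have := zI _ (GI k); rewrite mevalB mevalM mevalXU (raddf_sum (meval (z 0))) => /eqP.
  rewrite subr_eq0 => /eqP E; rewrite mxE E; apply: eq_bigr => j _ /=.
  by rewrite mevalM pull_rightE mxE.
have yortho t : (forall f, I f -> pairing (gradient f z) t = 0) -> pairing y (rsubmx t) = 0.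
  move=> Tt; apply: (mulfI dN0); rewrite mulr0 big_distrr /=.
  transitivity (\sum_j (M j).@[z 0] * pairing (gradient (h j) xi) (rsubmx t)); last first.
    by rewrite big1 // => j _; rewrite ortho // mulr0.
  under eq_bigr do rewrite mulrA yE big_distrl /=.
  rewrite exchange_big; apply: eq_bigr => j _; rewrite big_distrr /=.
  by apply: eq_bigr => k _; rewrite mulrA.
have key t t' : (forall f, I f -> pairing (gradient f z) t = 0) ->
    (forall f, I f -> pairing (gradient f z) t' = 0) ->
    delta.@[z 0] * pairing (lsubmx t) (rsubmx t') = S (rsubmx t) (rsubmx t').
  move=> Tt Tt'; pose dt f := pairing (gradient f z) t.
  have [dtD dtM] := pairing_gradient_derivation z t.
  have dD f g : dt (f + g) = dt f + dt g by exact: dtD.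
  have dM f g : dt (f * g) = f.@[z 0] * dt g + g.@[z 0] * dt f by exact: dtM.
  have dB f g : dt (f - g) = dt f - dt g by apply/(@addIr _ (dt g)); rewrite -dD !subrK.
  have d0 : dt 0 = 0 by rewrite -[0]subr0 dB subrr.
  have dS k : delta.@[z 0] * lsubmx t 0 k + y 0 k * dt delta =
     \sum_j (gradient (h j) xi 0 k * dt (M j) +
             (M j).@[z 0] * \sum_l ((h j)^`M(k)^`M(l)).@[xi 0] * rsubmx t 0 l).
    have := Tt _ (GI k); rewrite -/(dt _) dB => /eqP; rewrite subr_eq0 => /eqP.
    rewrite dM mevalXU [dt 'X_ _]pairing_gradientX => E.
    rewrite -[y 0 k]/(lsubmx z 0 k) ![lsubmx _ 0 k]mxE {}E.
    rewrite (big_morph dt dD d0); apply: eq_bigr => j _.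
    rewrite dM pull_rightE addrC mxE; congr (_ + _ * _).
    by rewrite /dt pull_right_diff; apply: eq_bigr => l _; rewrite mxE.
  transitivity (\sum_k (delta.@[z 0] * lsubmx t 0 k + y 0 k * dt delta) * rsubmx t' 0 k).
    under [RHS]eq_bigr do rewrite mulrDl.
    rewrite big_split /= [X in _ + X](_ : _ = dt delta * pairing y (rsubmx t')); last first.
      by rewrite big_distrr /=; apply: eq_bigr => k _; ring.
    rewrite yortho // mulr0 addr0 big_distrr /=.
    by apply: eq_bigr => k _; rewrite mulrA.
  under eq_bigr do rewrite dS big_distrl /=.
  rewrite exchange_big; apply: eq_bigr => j _.
  under eq_bigr do rewrite mulrDl.
  rewrite big_split /= [X in X + _](_ : _ =
    dt (M j) * pairing (gradient (h j) xi) (rsubmx t')); last first.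
    by rewrite big_distrr /=; apply: eq_bigr => k _; ring.
  rewrite ortho // mulr0 add0r big_distrr /=; apply: eq_bigr => k _.
  by rewrite -mulrA; congr (_ * _); rewrite big_distrl.
apply: (mulfI dN0); rewrite !key //; apply: eq_bigr => j _; congr (_ * _).
rewrite exchange_big; apply: eq_bigr => l _; apply: eq_bigr => k _.
by rewrite mderiv_comm mulrAC.
Qed.

End Differentials.

(** * The conormal variety *)

Lemma vanishing_closure (K : closedFieldType) n (Z : set 'rV[K]_n) :
  vanishing_ideal (zariski_closure Z) = vanishing_ideal Z.
Proof.
apply/seteqP; split=> f If x Zx; last exact: Zx.
by apply: If => g; apply.
Qed.

Section ConormalIrreducible.
Variables (K : closedFieldType) (n : nat) (X : set 'rV[K]_n).
Hypothesis charK0 : [pchar K] =i pred0.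
Hypothesis irrX : irreducible_set X.

(** A non-zero minor keeps the Jacobian rank from dropping, and
    [chain_rank_bound] keeps it from growing. *)
Lemma smooth_open x0 : smooth_locus X x0 ->
  exists2 delta : {mpoly K[n]}, delta.@[x0 0] != 0 &
    forall x, X x -> delta.@[x 0] != 0 -> smooth_locus X x.
Proof.
move=> /smooth_codim[c [f [d [If freeJ _ dimX cdn]]]].
have [delta [C [d0 deltaP]]] := minor_witness (mevalC (x0 0)) freeJ.
exists delta => // x Xx dx; have [_ freeJx] := deltaP K (meval (x 0)).
have {}freeJx := freeJx dx.
have [c' [f' [If' free' span']]] := independent_gradients (vanishing_ideal X) x.
have [[ch chainX] _] := dimX.
have c'dn := chain_rank_bound charK0 irrX chainX Xx If' free'.
have cc' : (c <= c')%N.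
  rewrite -(eqP freeJx) -(eqP free'); apply: mxrankS.
  by apply/row_subP => j; rewrite row_jacobian; apply: span'.
have c'c : c' = c.
  by apply/eqP; rewrite eqn_leq cc' andbT -(leq_add2r d) cdn.
by apply: (codim_smooth Xx If' free' span' dimX); rewrite c'c.
Qed.

Lemma conormal_gradient z : conormal_bundle X z ->
  exists2 u, vanishing_ideal X u & rsubmx z = gradient u (lsubmx z).
Proof.
move=> [/smooth_codim[c [f [d [If freeJ spanJ _ _]]]] annz].
exact: (annihilator_gradient If freeJ spanJ (vanishing_ideal_ideal X) annz).
Qed.

Lemma gradient_conormal x u : vanishing_ideal X u ->
  annihilator (var_tangent_space X x) (gradient u x).
Proof. by move=> Iu v /tangent_spaceP Tv; rewrite pairingC; apply: Tv. Qed.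

(** Pull-back by the section x |-> (x, grad u x), which takes values in the
    conormal bundle when [u] vanishes on [X].  These sections fill the bundle
    ([conormal_gradient]). *)
Definition gradient_graph (u : {mpoly K[n]}) : {mpoly K[n + n]} -> {mpoly K[n]} :=
  mmap (@mpolyC n K) (fun i => match fintype.split i with
                               | inl j => 'X_j | inr j => u^`M(j) end).

Lemma gradient_graphE u f (x : 'rV[K]_n) :
  (gradient_graph u f).@[x 0] = f.@[(row_mx x (gradient u x)) 0].
Proof.
rewrite meval_mmap; apply: meval_eq => i; rewrite mxE.
by case: fintype.split => j; rewrite ?mevalXU ?mxE.
Qed.

(** If neither [f] nor [g] vanishes on the bundle, each is non-zero on some
    section by gradients, hence over an open set of [X].  As [X] is irreducible,
    both are non-zero somewhere on the fibre over one smooth point; a fibre is a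
    linear space, so the product is non-zero there. *)
Lemma conormal_prime : conormal_bundle X !=set0 ->
  prime_ideal (vanishing_ideal (conormal_bundle X)).
Proof.
move=> [z Bz]; split; first exact: vanishing_ideal_ideal.
  by move=> /(_ z Bz) /eqP; rewrite meval1 oner_eq0.
move=> f g Ifg; apply: contrapT => /not_orP[/existsNP[z0 /not_implyP[B0 /eqP f0]]].
move=> /existsNP[z1 /not_implyP[B1 /eqP g1]].
have [u0 Iu0 z0E] := conormal_gradient B0; have [u1 Iu1 z1E] := conormal_gradient B1.
have [smooth0 _] := B0; have [smooth1 _] := B1.
have [delta d0 smoothP] := smooth_open smooth0.
have [_ _ primeM] := irreducible_prime irrX.
have [x0X _] := smooth0; have [x1X _] := smooth1.
have [x [Xx fx gx dx]] : exists x, [/\ X x, (gradient_graph u0 f).@[x 0] != 0,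
    (gradient_graph u1 g).@[x 0] != 0 & delta.@[x 0] != 0].
  apply: contrapT => nox.
  have /primeM[/primeM[]|] :
    vanishing_ideal X (gradient_graph u0 f * gradient_graph u1 g * delta).
  - move=> x Xx; apply: contrapT => /eqP; rewrite !mevalM !mulf_eq0 !negb_or -andbA.
    by move=> /and3P[fx gx dx]; apply: nox; exists x.
  - move/(_ _ x0X) => /eqP; rewrite gradient_graphE -z0E hsubmxK; exact/negP.
  - move/(_ _ x1X) => /eqP; rewrite gradient_graphE -z1E hsubmxK; exact/negP.
  - move/(_ _ x0X) => /eqP; exact/negP.
have smoothx := smoothP x Xx dx.
pose p0 := row_mx x (gradient u0 x).
pose w := row_mx (0 : 'rV[K]_n) (gradient u1 x - gradient u0 x).
have p1 : p0 + 1 *: w = row_mx x (gradient u1 x).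
  by rewrite scale1r /p0 /w add_row_mx addr0 addrC subrK.
rewrite !gradient_graphE -/p0 -p1 in fx gx.
have [||t] := @exists_common_nonroot K (line_poly f p0 w) (line_poly g p0 w).
- apply: contra_neq fx => l0; have -> : p0 = p0 + 0 *: w by rewrite scale0r addr0.
  by rewrite -line_polyE l0 horner0.
- by apply: contra_neq gx => l0; rewrite -line_polyE l0 horner0.
rewrite !line_polyE => -[ft gt]; have /eqP : (f * g).@[(p0 + t *: w) 0] = 0.
  apply: Ifg; rewrite /p0 /w scale_row_mx scaler0 add_row_mx addr0.
  split; rewrite ?row_mxKl ?row_mxKr // => v Tv.
  have g0 := gradient_conormal Iu0 Tv.
  have g1' := gradient_conormal Iu1 Tv.
  rewrite pairing_mulmx linearD linearZ linearB /= mulmxDr -scalemxAr mulmxBr !mxE.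
  move: g0 g1'; rewrite !pairing_mulmx !mxE => -> ->.
  by rewrite subrr mulr0 addr0.
by rewrite mevalM mulf_eq0 (negPf ft) (negPf gt).
Qed.

End ConormalIrreducible.

Lemma conormal_nonempty (K : closedFieldType) n (X : set 'rV[K]_n) z :
  conormal_variety X z -> conormal_bundle X !=set0.
Proof.
move=> Iz; apply: contrapT => noB; have /eqP : (1 : {mpoly K[n + n]}).@[z 0] = 0.
  by apply: Iz => x Bx; case: noB; exists x.
by rewrite meval1 oner_eq0.
Qed.

Section DualOrthogonality.
Variables (K : closedFieldType) (N : nat) (X : set 'rV[K]_N.+1).
Hypothesis homX : homogeneous_closed X.
Local Notation n := N.+1.

Lemma euler_conormal : vanishing_ideal (conormal_bundle X)
  (\sum_(k < n) 'X_(lshift n k) * 'X_(rshift n k)).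
Proof.
move=> z Bz; have [u Iu zE] := conormal_gradient Bz; have [[Xz _] _] := Bz.
rewrite (raddf_sum (meval (z 0))) -[RHS](euler_tangent homX Xz Iu) -zE.
by apply: eq_bigr => k _ /=; rewrite mevalM !mevalXU !mxE mulrC.
Qed.

(** The contact form xi dx vanishes on the bundle, whose points are gradients of
    equations of [X].  Since [X] is a cone, <x, xi> also vanishes there, so x dxi
    vanishes as well. *)
Lemma bundle_tangent_orthogonal z v : conormal_bundle X z ->
  tangent_space (vanishing_ideal (conormal_bundle X)) z v ->
  pairing (lsubmx z) (rsubmx v) = 0.
Proof.
move=> Bz /tangent_spaceP Tv; have [u Iu zE] := conormal_gradient Bz.
have Iul : vanishing_ideal (conormal_bundle X) (pull_left u).
  by move=> t [[Xt _] _]; rewrite pull_leftE; apply: Iu.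
have := Tv _ Iul; rewrite pull_left_diff -zE => contact.
have := Tv _ euler_conormal; have [dD dM] := pairing_gradient_derivation z v.
pose dv f := pairing (gradient f z) v; rewrite -/(dv _).
have d0 : dv 0 = 0 by rewrite /dv -mpolyC0 pairing_gradientC.
rewrite (big_morph dv dD d0) => sum0.
transitivity (pairing (lsubmx z) (rsubmx v) + pairing (rsubmx z) (lsubmx v)).
  by rewrite contact addr0.
rewrite -sum0 -big_split.
apply: eq_bigr => k _ /=; rewrite [RHS]dM !pairing_gradientX !mevalXU !mxE.
by rewrite addrC.
Qed.

Lemma bundle_scale z (lambda : K) : conormal_bundle X z ->
  conormal_bundle X (row_mx (lsubmx z) (lambda *: rsubmx z)).
Proof.
move=> [smz annz]; split; rewrite ?row_mxKl ?row_mxKr // => v Tv.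
by rewrite pairing_mulmx linearZ /= -scalemxAr mxE -pairing_mulmx annz // mulr0.
Qed.

Lemma conormal_scale z (lambda : K) : conormal_variety X z ->
  conormal_variety X (row_mx (lsubmx z) (lambda *: rsubmx z)).
Proof.
move=> Iz f If.
pose s i := match fintype.split i with
  | inl j => 'X_(lshift n j) | inr j => lambda%:MP * 'X_(rshift n j) end : {mpoly K[n + n]}.
have sE (t : 'rV[K]_(n + n)) :
    (mmap (@mpolyC (n + n) K) s f).@[t 0] = f.@[(row_mx (lsubmx t) (lambda *: rsubmx t)) 0].
  rewrite meval_mmap; apply: meval_eq => i; rewrite mxE /s.
  by case: fintype.split => j; rewrite ?mevalM ?mevalC ?mevalXU !mxE.
rewrite -sE; apply: Iz => t Bt; rewrite sE; apply: If; exact: bundle_scale.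
Qed.

End DualOrthogonality.

(** * The cone over an affine chart *)

Lemma dhomog_mderiv (K : comNzRingType) n d (f : {mpoly K[n]}) i :
  f \is d.-homog -> f^`M(i) \is d.-1.-homog.
Proof.
move=> /dhomogP homf; apply/dhomogP => m; rewrite mcoeff_msupp mcoeff_mderiv => fm.
have : (m + U_(i))%MM \in msupp f.
  by rewrite mcoeff_msupp; apply: contra_neq fm => ->; rewrite mul0rn.
by move/homf <-; rewrite /= mdegD mdeg1 addn1.
Qed.

(** Deleting a column and rescaling the rows do not increase the rank. *)
Lemma row_free_lift (K : fieldType) c N (i : 'I_N.+1) (e : 'I_c -> K)
    (A : 'M[K]_(c, N)) (J : 'M[K]_(c, N.+1)) :
  (forall j, e j != 0) -> (forall j k, J j (lift i k) = e j * A j k) ->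
  row_free A -> row_free J.
Proof.
move=> eN0 JA /row_freeP[B AB]; apply/row_freeP.
exists (\matrix_(l, j) oapp (fun k => B k j / e j) 0 (unlift i l)).
apply/matrixP => j j'; rewrite mxE (bigD1_ord i) //= mxE unlift_none mulr0 add0r.
transitivity (e j / e j' * (A *m B) j j').
  by rewrite mxE big_distrr /=; apply: eq_bigr => k _; rewrite mxE liftK JA /=; ring.
rewrite AB mxE; case: eqP => [->|]; last by rewrite mulr0.
by rewrite mulr1 divff.
Qed.

Section ConeOverChart.
Variables (K : closedFieldType) (N : nat) (i : 'I_N.+1).

Definition cone_ideal (Z : set 'rV[K]_N) : set {mpoly K[N.+1]} :=
  [set h | forall b, Z b -> forall lambda : K, h.@[(lambda *: chart_point i b) 0] = 0].

Lemma chart_point_coord (xi : 'rV[K]_N.+1) : xi 0 i != 0 ->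
  xi = xi 0 i *: chart_point i (chart_coord i xi).
Proof.
move=> xiN0; apply/rowP => j; rewrite !mxE.
case: unliftP => [k ->|->] /=; last by rewrite mulr1.
by rewrite !mxE mulrA divff // mul1r.
Qed.

(** The cone is the image of [Z] times a line. *)
Lemma cone_ideal_prime Z : irreducible_set Z -> prime_ideal (cone_ideal Z).
Proof.
move=> irrZ; have [[b0 Zb0] _] := irrZ; have [_ _ primeZ] := irreducible_prime irrZ.
split.
- split=> [b _ l|f g If Ig b Zb l|f g Ig b Zb l]; first by rewrite meval0.
    by rewrite mevalD If // Ig // addr0.
  by rewrite mevalM (Ig b) // mulr0.
- by move/(_ b0 Zb0 1)/eqP; rewrite meval1 oner_eq0.
move=> f g Ifg; apply: contrapT => /not_orP[].
move=> /existsNP[b /not_implyP[Zb /existsNP[s /eqP fs]]].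
move=> /existsNP[b' /not_implyP[Zb' /existsNP[t /eqP gt]]].
have [p [Zp fp gp]] : exists p, [/\ Z p, (chart_subst i s f).@[p 0] != 0 &
    (chart_subst i t g).@[p 0] != 0].
  apply: contrapT => nop.
  have /primeZ[] : vanishing_ideal Z (chart_subst i s f * chart_subst i t g).
  - move=> x Zx; apply: contrapT => /eqP; rewrite mevalM mulf_eq0 negb_or.
    by move=> /andP[fx gx]; apply: nop; exists x.
  - by move/(_ b Zb) => /eqP; rewrite chart_substE; exact/negP.
  - by move/(_ b' Zb') => /eqP; rewrite chart_substE; exact/negP.
rewrite !chart_substE -!scale_line_poly in fp gp.
have [||r [fr gr]] := @exists_common_nonroot K
  (line_poly f 0 (chart_point i p)) (line_poly g 0 (chart_point i p)).
- by apply: contra_neq fp => ->; rewrite horner0.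
- by apply: contra_neq gp => ->; rewrite horner0.
have /eqP := Ifg p Zp r; rewrite mevalM mulf_eq0 -!scale_line_poly.
by rewrite (negPf fr) (negPf gr).
Qed.

(** A chain of length [d] in the chart gives the chain of the cones over its
    members, which the origin extends by one step. *)
Lemma cone_chain_alg_independent V d C : irreducible_chain V d C ->
  exists g : 'I_d.+1 -> {mpoly K[N.+1]}, alg_independent (cone_ideal (C d)) g.
Proof.
move=> [irrC strictC].
pose origin : set {mpoly K[N.+1]} := [set h | h.@[(0 : 'rV[K]_N.+1) 0] = 0].
pose P k := if k is j.+1 then cone_ideal (C j) else origin.
apply: (@chain_alg_independent K N.+1 P d.+1) => [[_|k kd]|[_|k kd]] /=.
- split.
  + split=> [|f g f0 g0|f g g0]; rewrite /origin /= ?meval0 //.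
      by rewrite mevalD f0 g0 addr0.
    by rewrite mevalM g0 mulr0.
  + by rewrite /origin /= meval1 => /eqP; rewrite oner_eq0.
  + move=> f g; rewrite /origin /= mevalM => /eqP; rewrite mulf_eq0.
    by move=> /orP[]/eqP; [left|right].
- by have [_ irrCk _] := irrC k kd; apply: cone_ideal_prime.
- have [_ [[b C0b] _] _] := irrC 0%N isT; split=> [f If|].
    by have := If b C0b 0; rewrite scale0r.
  move/(_ 'X_i); rewrite /origin /= mevalXU mxE => /(_ erefl)/(_ b C0b 1)/eqP.
  by rewrite scale1r mevalXU mxE unlift_none /= oner_eq0.
- have [clC _ _] := irrC k (ltnW kd).
  have [IC /existsNP[f /not_implyP[If nIf]]] := vanishing_ideal_proper clC (strictC k kd).
  have [D [h [homh hf h0]]] := exists_homogenization i f.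
  have hE l b : h.@[(l *: chart_point i b) 0] = l ^+ D * f.@[b 0].
    by rewrite (dhomog_scale _ _ homh) -hf chart_substE scale1r.
  split=> [g Ig b Cb l|]; first by apply: Ig; apply: (proj1 (strictC k kd)).
  move=> /(_ h) Ihh; apply: nIf => b Cb.
  have := Ihh _ b Cb 1; rewrite hE expr1n mul1r; apply => b' Cb' l.
  by rewrite hE If // mulr0.
Qed.

End ConeOverChart.

(** * Reflexivity over the smooth part of the dual *)

Section Reflexivity.
Variables (K : closedFieldType) (N : nat) (X : set 'rV[K]_N.+1).
Hypothesis charK0 : [pchar K] =i pred0.
Hypothesis homX : homogeneous_closed X.
Hypothesis irrX : irreducible_set X.
Local Notation n := N.+1.
Local Notation I := (vanishing_ideal (conormal_bundle X)).

(** Equations of the dual variety as a cone, from its smoothness in a chart.  The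
    polynomials [g] express that this cone has dimension at least [d], in a form
    which can be used at a generic point of the conormal variety. *)
Lemma exists_dual_equations i (xi : 'rV[K]_n) : xi 0 i != 0 ->
  smooth_locus (chart_point i @^-1` dual_variety X) (chart_coord i xi) ->
  exists c (h : 'I_c -> {mpoly K[n]}) d (g : 'I_d -> {mpoly K[n]}),
    [/\ (c + d = n)%N, row_free (map_mx (meval (xi 0)) (jacobian h)),
        forall j, I (pull_right (h j)) &
        alg_independent [set f | I (pull_right f)] g].
Proof.
move=> xi0 /smooth_codim[c [f [d [If freeJ _ [[C chainC] _] cdN]]]].
have homf j := exists_homogenization i (f j).
have [D /boolp.choice[h hP]] := boolp.choice homf.
have [g indg] := cone_chain_alg_independent i chainC.
exists c, h, d.+1, g; split.
- by rewrite addnS cdN.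
- pose e j := xi 0 i ^+ (D j).-1.
  apply: (row_free_lift (i := i) (e := e)) freeJ => [j|j k]; first by rewrite expf_neq0.
  have [homh hf _] := hP j; rewrite !mxE [in LHS](chart_point_coord xi0).
  rewrite (dhomog_scale _ _ (dhomog_mderiv _ homh)) -hf chart_subst_deriv.
  by rewrite chart_substE scale1r.
- move=> j z Bz; have [homh hf h0] := hP j; rewrite pull_rightE.
  have [zi0|/eqP ziN0] := pselect (rsubmx z 0 i = 0); first exact: h0.
  rewrite (chart_point_coord ziN0) (dhomog_scale _ _ homh).
  rewrite -[chart_point i _]scale1r -chart_substE hf If ?mulr0 //.
  exists (row_mx (lsubmx z) ((rsubmx z 0 i)^-1 *: rsubmx z)).
    by apply: zero_locus_vanishing; apply: bundle_scale.
  rewrite row_mxKr; apply: (scalerI ziN0); rewrite scalerA divff // scale1r.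
  exact: chart_point_coord.
- have [_ _ CV] := chainC.1 d (leqnn d).
  move=> H IH; apply: indg => b /CV [z Iz zE] lambda.
  have := conormal_scale lambda Iz; rewrite zE => Iz'.
  by have := Iz' _ IH; rewrite pull_rightE row_mxKr.
Qed.

(** Biduality: at a generic point (x, xi) of the conormal variety, x is orthogonal
    to the tangent space at xi of the dual variety.  Indeed a tangent vector at
    xi lifts to the conormal variety, where x dxi = 0.  By dimension x is
    then a combination of the gradients of the [h j]. *)
Lemma dual_span_equations c (h : 'I_c -> {mpoly K[n]}) d (g : 'I_d -> {mpoly K[n]})
    (z : 'rV[K]_(n + n)) :
  conormal_variety X z -> (c + d = n)%N ->
  row_free (map_mx (meval (rsubmx z 0)) (jacobian h)) ->
  (forall j, I (pull_right (h j))) ->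
  alg_independent [set f | I (pull_right f)] g ->
  exists (delta : {mpoly K[n + n]}) (M : 'I_c -> {mpoly K[n + n]}),
    delta.@[z 0] != 0 /\
    forall k, I (delta * 'X_(lshift n k) - \sum_j M j * pull_right (h j)^`M(k)).
Proof.
move=> Iz cdn freeJ Ih indg.
have primeI := conormal_prime charK0 irrX (conormal_nonempty Iz).
have [U [F [cls [ultraU UB cls_surj cls0 genB]]]] := exists_generic_class primeI.
pose iota := const_class cls; pose zeta := class_point cls.
pose xi k := mmap iota zeta ('X_(rshift n k)).
have xiE f : mmap iota xi f = mmap iota zeta (pull_right f).
  rewrite (rmorph_mmap _ (mmap iota zeta)); congr (mmap _ _ f).
  by apply/funext => a /=; rewrite mmapC.
have charF0 := const_class_pchar cls charK0.
have [|W [freeW tanW]] := @tangent_vectors K F charF0 iota n xi d g.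
  by move=> H /=; rewrite xiE => /genB IH; apply: indg.
pose x : 'rV[F]_n := \row_k zeta (lshift n k).
(* The relation x dxi = 0 holds at almost all points of the bundle, so it holds
   at the generic point. *)
have orthoW l : \sum_k x 0 k * W l k = 0.
  have [v [tan_v vW]] := tangent_lift charF0 (tanW l).
  have [v' vE] := @boolp.choice _ _ (fun i f => cls f = v i) (fun i => cls_surj (v i)).
  have vcls : v = cls \o v' by apply/funext => i; rewrite /= vE.
  rewrite vcls in tan_v.
  have UI : U (zero_locus I) by apply: filterS UB => t; apply: zero_locus_vanishing.
  have Utan := tangent_class ultraU cls0 (vanishing_ideal_ideal _) UI tan_v.
  pose s (t : 'rV[K]_(n + n)) := \sum_(k < n) t 0 (lshift n k) * v' (rshift n k) t.
  transitivity (cls s); last first.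
    apply/cls0; apply: filterS2 UB Utan => t Bt Tt.
    rewrite /= -[RHS](bundle_tangent_orthogonal homX Bt Tt).
    by apply: eq_bigr => k _; rewrite !mxE.
  have -> : s = \sum_(k < n)
      (fun t : 'rV[K]_(n + n) => t 0 (lshift n k)) * v' (rshift n k).
    by rewrite fct_sumE.
  rewrite rmorph_sum; apply: eq_bigr => k _; rewrite rmorphM mxE /=; congr (_ * _).
  by rewrite -vW vcls point_diffX.
pose phi : {rmorphism {mpoly K[n]} -> F} := mmap iota xi.
have [delta [C [deltaz deltaP]]] := minor_witness (mevalC (rsubmx z 0)) freeJ.
have [spanP freeP] := deltaP F phi.
have freeJF : row_free (map_mx phi (jacobian h)).
  apply: freeP; apply/eqP; rewrite /phi /= xiE => /genB Id.
  have := Iz _ Id; rewrite pull_rightE => /eqP; exact/negP.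
have xJ : (x <= map_mx phi (jacobian h))%MS.
  apply: (orthogonal_span freeJF freeW); last 2 first.
  - by rewrite cdn.
  - by apply/rowP => l; rewrite !mxE -[RHS](orthoW l); apply: eq_bigr => k _; rewrite !mxE.
  apply/matrixP => j l; rewrite !mxE.
  have hj0 : mmap iota xi (h j) = 0 by rewrite xiE; apply/genB.
  by rewrite -[RHS](tanW l _ hj0); apply: eq_bigr => k _; rewrite !mxE.
have := spanP x xJ => xE.
(* Cramer's formula at the generic point is an equation of I_X. *)
exists (pull_right delta), (fun j => \sum_k 'X_(lshift n k) * pull_right (C k j)).
split=> [|k]; first by rewrite pull_rightE.
apply/genB; rewrite rmorphB rmorphM /= -xiE mmapX mmap1U.
apply/eqP; rewrite subr_eq0; apply/eqP.
have := congr1 (fun u : 'rV[F]_n => u 0 k) xE; rewrite !mxE => ->.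
rewrite rmorph_sum; apply: eq_bigr => j _; rewrite rmorphM /= -xiE !mxE.
congr (_ * _); rewrite rmorph_sum; apply: eq_bigr => l _.
by rewrite rmorphM /= -xiE !mxE mmapX mmap1U.
Qed.

Lemma conormal_isotropic z : conormal_variety X z ->
  proj_smooth_locus (dual_variety X) (rsubmx z) ->
  forall t1 t2, tangent_space (vanishing_ideal (conormal_variety X)) z t1 ->
    tangent_space (vanishing_ideal (conormal_variety X)) z t2 ->
    pairing (lsubmx t1) (rsubmx t2) = pairing (lsubmx t2) (rsubmx t1).
Proof.
move=> Iz [i [xi0 smooth_xi]].
have [c [h [d [g [cdn freeJ Ih indg]]]]] := exists_dual_equations xi0 smooth_xi.
have [delta [M [dN0 IM]]] := dual_span_equations Iz cdn freeJ Ih indg.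
rewrite vanishing_closure; exact: (isotropic_tangent Iz Ih IM dN0).
Qed.

End Reflexivity.

(** * The scheme-theoretic fibre and condition (a) *)

Section FibreTangent.
Variables (K : closedFieldType) (n : nat) (X : set 'rV[K]_n) (y : 'rV[K]_n).
Local Notation I := (vanishing_ideal (conormal_variety X)).

Definition fibre_subst : {mpoly K[n + n]} -> {mpoly K[n]} :=
  mmap (@mpolyC n K) (fun i => match fintype.split i with
                               | inl j => (y 0 j)%:MP | inr j => 'X_j end).
HB.instance Definition _ := GRing.RMorphism.on fibre_subst.

Lemma fibre_substE f (xi : 'rV[K]_n) : (fibre_subst f).@[xi 0] = f.@[(row_mx y xi) 0].
Proof.
rewrite meval_mmap; apply: meval_eq => i; rewrite mxE.
by case: fintype.split => j; rewrite ?mevalC ?mevalXU.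
Qed.

(** Modulo the x_i - y_i, a polynomial in (x, xi) is its value at x = y. *)
Lemma fibre_subst_ideal g : I g -> dual_fibre_ideal X y (fibre_subst g).
Proof.
move=> Ig; suff [h hE] : exists h : 'I_n -> {mpoly K[n + n]},
    fibre_subst g \mPo [tuple 'X_(rshift n i) | i < n] =
    g + \sum_(i < n) h i * ('X_(lshift n i) - (y 0 i)%:MP) by exists g, h.
elim/mpoly_ring_ind: g {Ig} => [c|i|p q [h hE] [k kE]|p q [h hE] [k kE]].
- exists (fun=> 0); rewrite /fibre_subst mmapC comp_mpolyC big1 ?addr0 // => i _.
  by rewrite mul0r.
- rewrite /fibre_subst mmapX mmap1U; case: split_ordP => j ->.
    exists (fun l => - (l == j)%:R); rewrite comp_mpolyC (bigD1 j) //= big1 ?addr0.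
      by rewrite eqxx mulN1r opprB addrC subrK.
    by move=> l lj; rewrite (negPf lj) oppr0 mul0r.
  exists (fun=> 0); rewrite comp_mpolyXU big1 ?addr0 => [|l _]; last by rewrite mul0r.
  by rewrite -tnth_nth tnth_mktuple.
- exists (fun i => h i + k i); rewrite rmorphD comp_mpolyD /= hE kE addrACA -big_split.
  by congr (_ + _); apply: eq_bigr => i _; rewrite mulrDl.
- pose r := \sum_(i < n) h i * ('X_(lshift n i) - (y 0 i)%:MP).
  exists (fun i => (q + \sum_(j < n) k j * ('X_(lshift n j) - (y 0 j)%:MP)) * h i + p * k i).
  rewrite rmorphM [LHS]rmorphM /= hE kE.
  under [in RHS]eq_bigr do rewrite mulrDl -!mulrA.
  by rewrite big_split /= -!big_distrr /=; ring.
Qed.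

Lemma zero_locus_fibre xi : zero_locus (dual_fibre_ideal X y) xi ->
  conormal_variety X (row_mx y xi).
Proof.
move=> zxi f If; rewrite -fibre_substE; apply: zxi; apply: fibre_subst_ideal.
by rewrite vanishing_closure.
Qed.

Lemma tangent_fibre xi v : tangent_space (dual_fibre_ideal X y) xi v ->
  tangent_space I (row_mx y xi) (row_mx 0 v).
Proof.
move=> /tangent_spaceP Tv; apply/tangent_spaceP => f If.
rewrite -[RHS](Tv _ (fibre_subst_ideal If)) gradient_subst.
apply: eq_bigr => i _; rewrite !mxE; congr (_ * _).
  apply: meval_eq => j; rewrite mxE.
  by case: fintype.split => l; rewrite ?mevalC ?mevalXU.
by case: fintype.split => l; rewrite ?pairing_gradientC ?pairing_gradientX ?mxE.
Qed.

End FibreTangent.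

(** The vectors orthogonal to a given [w] form a closed linear subspace. *)
Lemma orthogonal_whitney (K : closedFieldType) n (X Y : set 'rV[K]_n) y :
  (forall xi v w, (zero_locus (dual_fibre_ideal X y) `\ 0) xi ->
     tangent_space (dual_fibre_ideal X y) xi v -> var_tangent_space Y y w ->
     pairing w v = 0) ->
  whitney_a X Y y.
Proof.
move=> ortho v spanv w Tw.
pose L := linfun (mulmx w \o trmx : 'rV[K]_n -> 'M[K]_1).
have LE u : (u \in lker L) = (pairing w u == 0).
  rewrite memv_ker lfunE /= pairing_mulmx; apply/eqP/eqP => [->|E]; first by rewrite mxE.
  by apply/matrixP => a b; rewrite !ord1 E mxE.
apply/eqP; rewrite -LE; apply: spanv => u clu /=; rewrite LE; apply/eqP.
pose p : {mpoly K[n]} := \sum_i (w 0 i)%:MP * 'X_i.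
have pE (t : 'rV[K]_n) : p.@[t 0] = pairing w t.
  rewrite (raddf_sum (meval (t 0))); apply: eq_bigr => i _ /=.
  by rewrite mevalM mevalC mevalXU.
rewrite -pE; apply: clu => t [xi zxi Tt]; rewrite pE; exact: ortho Tt Tw.
Qed.

Theorem generic_whitney (K : closedFieldType) (charK0 : [pchar K] =i pred0) N
    (X Y : set 'rV[K]_N.+1) :
  homogeneous_closed X -> irreducible_set X -> irreducible_set Y ->
  generically Y (fun y =>
       zero_locus (dual_fibre_ideal X y) `\ 0
         `<=` proj_smooth_locus (dual_variety X)) ->
  generically Y (fun y => whitney_a X Y y).
Proof.
move=> homX irrX irrY [O [oO YO smoothO]].
pose V := [set z | conormal_variety X z /\ Y (lsubmx z)].
(* Only the part of I_X over Y is submerged in Y; its tangent vectors are tangent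
   to I_X. *)
have [O' [oO' YO' submO']] := @generic_submersion K charK0 _ Y V irrY (fun z => @proj2 _ _).
exists (O `&` O'); split; first exact: zariski_openI.
  exact: irreducible_openI.
move=> y Yy [Oy O'y]; apply: orthogonal_whitney => xi v w zxi Tv Tw.
have Iz := zero_locus_fibre zxi.1.
have [eta Teta] : exists eta, var_tangent_space V (row_mx y xi) (row_mx w eta).
  by apply: submO'; rewrite ?row_mxKl //; split; rewrite ?row_mxKl.
have Teta' : tangent_space (vanishing_ideal (conormal_variety X))
    (row_mx y xi) (row_mx w eta).
  by move=> f If; apply: Teta => z [Iz' _]; apply: If.
have := conormal_isotropic charK0 homX irrX Iz; rewrite row_mxKr.
move/(_ (smoothO y Yy Oy xi zxi) _ _ Teta' (tangent_fibre Tv)).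
rewrite !row_mxKl !row_mxKr => ->.
by rewrite /pairing big1 // => i _; rewrite mxE mul0r.
Qed.

Theorem theorem2p2p3 (R : realType) (N : nat) (X Y : set 'rV[R[i]]_N.+1)
    (hX : cone_over_projective_variety X)
    (hY : cone_over_projective_variety Y)
    (hYX : Y `<=` X)
    (hsmooth : generically Y (fun y =>
       zero_locus (dual_fibre_ideal X y) `\ 0
         `<=` proj_smooth_locus (dual_variety X))) :
  generically Y (fun y => whitney_a X Y y).
Proof.
have [homX _ _] := hX.
apply: generic_whitney hsmooth => //; try exact: cone_irreducible.
exact: Num.Theory.pchar_num.
Qed.
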